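(* Let $D\subset\mathbb{C}^n$ be a smoothly bounded complete pseudoconvex Reinhardt domain, and let $K\subset\partial D$ be a multi-circular compact set that does not meet any of the hyperplanes $\{z_j=0\}$, $j=1,\dots,n$. Then all the inequalities in $$\omega_1(z,K,D)\le \omega(z,K,D)\le\tilde\omega(z,K,D)\le\omega_3(z,K,D),\qquad z\in D,$$ are equalities. In particular, the upper semicontinuous regularizations of these four functions coincide.
   Context: $\mathrm{PSH}(D)$ denotes the family of all plurisubharmonic functions on $D$. For $u:D\to\mathbb{R}\cup\{-\infty\}$ and $x\in\overline D$, the upper semicontinuous regularization on $\overline D$ is $u^*(x)=\limsup_{z\to x,\,z\in D}u(z)=\lim_{r\to0}\sup_{B(x,r)\cap D}u$. A subset of $\mathbb{C}^n$ is multi-circular if it is invariant under $(z_1,\dots,z_n)\mapsto(e^{i\theta_1}z_1,\dots,e^{i\theta_n}z_n)$ for all real $\theta_1,\dots,\theta_n$. A complete pseudoconvex Reinhardt domain is a pseudoconvex domain that is multi-circular and balanced ($z\in D$, $\lambda\in\mathbb{C}$, $|\lambda|\le1$ imply $\lambda z\in D$). For $\xi\in\partial D$ and $\alpha>1$ let $C_\alpha(\xi)=\{z\in D:|z-\xi|<\alpha\delta_\xi(z)\}$, where $\delta_\xi(z)$ is the distance from $z$ to the real tangent space at $\xi$ to $\partial D$. For a function $u$ on $D$ set $u^{\#}(\xi)=\sup_{\alpha>1}\limsup_{z\to\xi,\,z\in C_\alpha(\xi)}u(z)$. For $A\subset\partial D$ and $z\in D$ define: - $\omega(z,A,D)=\sup\{u(z):u\in\mathrm{PSH}(D),\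 u\le0,\ u^*\le-1\text{ on }A\}$; - $\omega_1(z,A,D)=\sup\{u(z):u\in\mathrm{PSH}(D)\cap C(\overline D),\ u\le0,\ u|_A\le-1\}$; - $\tilde\omega(z,A,D)=\sup\{u(z):u\in\mathrm{PSH}(D),\ u\le0,\ u^{\#}|_A\le-1\}$; - $\omega_3(z,A,D)=\sup\{u(z):u\in\mathrm{PSH}(D),\ u\le0,\ \limsup_{w\to\zeta,\,w\in n_\zeta}u(w)\le-1\text{ for all }\zeta\in A\}$, where $n_\zeta$ is the inward normal to $\partial D$ at $\zeta$. *)

(* Defs.v *)
From HB Require Import structures.
From mathcomp Require Import all_boot all_order all_algebra.
From mathcomp Require Import all_classical all_reals all_analysis.
From mathcomp Require Import complex.

Set Implicit Arguments.
Unset Strict Implicit.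
Unset Printing Implicit Defensive.

Import Order.TTheory GRing.Theory Num.Theory.
Import numFieldNormedType.Exports.

Local Open Scope classical_set_scope.
Local Open Scope ring_scope.
Local Open Scope complex_scope.

(* C^n; the regular algebra R[i]^o is what carries the topology of C.
   Functions on a set D are total functions whose values off D (off closure D
   for functions continuous up to the boundary) are never inspected. *)
Notation "''Cn[' R ]_ n" := 'rV[(R[i])^o]_n
  (at level 8, n at level 2, format "''Cn[' R ]_ n").

Section Euclidean.
Context {R : realType} {n : nat}.
Implicit Types v w z : 'Cn[R]_n.

(* The inner product of R^{2n} = C^n, i.e. the real part of the Hermitian one. *)
Definition rdot v w : R :=
  \sum_(j < n) (complex.Re (v ord0 j) * complex.Re (w ord0 j) +
                  complex.Im (v ord0 j) * complex.Im (w ord0 j)).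

Definition enorm v : R := Num.sqrt (rdot v v).

Definition dist_to (T : set 'Cn[R]_n) z : R := inf [set enorm (z - w) | w in T].

End Euclidean.

Section Smooth.
Context {R : realType} {n : nat}.
Implicit Types (f rho : 'Cn[R]_n -> R) (U D : set 'Cn[R]_n).

Definition rline f (z v : 'Cn[R]_n) : R -> R := fun t => f (z + t%:C *: v).

(* Derivative of f along the real direction v. *)
Definition rderive (v : 'Cn[R]_n) f : 'Cn[R]_n -> R :=
  fun z => derive1 (rline f z v) 0.

Fixpoint Ck (k : nat) U f : Prop :=
  (forall z, U z -> {for z, continuous f}) /\
  if k is k'.+1 then
    forall v, (forall z, U z -> derivable (rline f z v) 0 1) /\
              Ck k' U (rderive v f)
  else True.

Definition smooth_on U f := forall k, Ck k U f.

(* The gradient (d/dx_j + i d/dy_j)_j, i.e. the vector representing the real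
   differential of f with respect to rdot. *)
Definition grad f (z : 'Cn[R]_n) : 'Cn[R]_n :=
  \row_j (rderive (delta_mx ord0 j) f z
          +i* rderive ((0 +i* 1) *: delta_mx ord0 j) f z).

Definition bd D : set 'Cn[R]_n := closure D `\` interior D.

Definition local_defining D (xi : 'Cn[R]_n) U rho :=
  [/\ open U, U xi, smooth_on U rho,
      D `&` U = [set z | rho z < 0] `&` U & grad rho xi != 0].

Definition smoothly_bounded D :=
  bounded_set D /\
  forall xi, bd D xi -> exists U rho, local_defining D xi U rho.

(* The real affine hyperplane tangent to bd D at xi, and the open half-line
   from xi along the inward normal.  Neither depends on the defining function:
   any two have positively proportional gradients at xi. *)
Definition real_tangent D (xi : 'Cn[R]_n) : set 'Cn[R]_n :=
  [set z | exists U rho,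
     local_defining D xi U rho /\ rdot (z - xi) (grad rho xi) = 0].

Definition inward_normal D (xi : 'Cn[R]_n) : set 'Cn[R]_n :=
  [set z | exists U rho, local_defining D xi U rho /\
     exists2 t : R, 0 < t & z = xi - t%:C *: grad rho xi].

Definition approach_region D (alpha : R) (xi : 'Cn[R]_n) : set 'Cn[R]_n :=
  [set z | D z /\ enorm (z - xi) < alpha * dist_to (real_tangent D xi) z].

End Smooth.

Section Plurisubharmonic.
Context {R : realType} {n : nat}.
Implicit Types (D A : set 'Cn[R]_n) (u : 'Cn[R]_n -> \bar R).

Definition expi (t : R) : R[i] := cos t +i* sin t.

Definition usc_on D u :=
  forall z (a : R), D z -> (u z < a%:E)%E ->
    \forall w \near within D (nbhs z), (u w < a%:E)%E.

(* The constant -oo is plurisubharmonic with this convention. *)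
Definition psh D u :=
  [/\ forall z, D z -> (u z < +oo)%E,
      usc_on D u &
      forall z w : 'Cn[R]_n,
        (forall l : R[i], `|l| <= 1 -> D (z + l *: w)) ->
        (u z <= (2 * pi)^-1%:E *
          \int[lebesgue_measure]_(t in `[0%R, (2 * pi)%R])
             u (z + expi t *: w)%R)%E].

Definition ustar D u (x : 'Cn[R]_n) : \bar R := limf_esup u (within D (nbhs x)).

Definition usharp D u (xi : 'Cn[R]_n) : \bar R :=
  ereal_sup [set limf_esup u (within (approach_region D alpha xi) (nbhs xi))
            | alpha in [set alpha : R | 1 < alpha]].

Definition psh_le0 D u := psh D u /\ forall z, D z -> (u z <= 0)%E.

Definition omega (z : 'Cn[R]_n) A D : \bar R :=
  ereal_sup [set u z | u in
    [set u | psh_le0 D u /\ forall x, A x -> (ustar D u x <= - 1%:E)%E]].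

(* Members of C(closure D) are finite-valued. *)
Definition omega1 (z : 'Cn[R]_n) A D : \bar R :=
  ereal_sup [set u z | u in
    [set u | [/\ psh_le0 D u,
                 forall x, closure D x -> u x \is a fin_num,
                 {within closure D, continuous u} &
                 forall x, A x -> (u x <= - 1%:E)%E]]].

Definition omega_tilde (z : 'Cn[R]_n) A D : \bar R :=
  ereal_sup [set u z | u in
    [set u | psh_le0 D u /\ forall x, A x -> (usharp D u x <= - 1%:E)%E]].

Definition omega3 (z : 'Cn[R]_n) A D : \bar R :=
  ereal_sup [set u z | u in
    [set u | psh_le0 D u /\ forall x, A x ->
       (limf_esup u (within (D `&` inward_normal D x) (nbhs x)) <= - 1%:E)%E]].

End Plurisubharmonic.

Section Reinhardt.
Context {R : realType} {n : nat}.
Implicit Types D A : set 'Cn[R]_n.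

Definition domain D := [/\ D !=set0, open D & connected D].

(* Existence of a continuous plurisubharmonic exhaustion function. *)
Definition pseudoconvex D :=
  exists phi : 'Cn[R]_n -> R,
    [/\ psh D (EFin \o phi),
        {within D, continuous phi} &
        forall c : R, exists2 L : set 'Cn[R]_n,
          compact L /\ L `<=` D & [set z | D z /\ phi z < c] `<=` L].

Definition multicircular A :=
  forall (theta : 'I_n -> R) (z : 'Cn[R]_n), A z ->
    A (\row_j (expi (theta j) * z ord0 j)).

Definition balanced D :=
  forall (z : 'Cn[R]_n) (l : R[i]), D z -> `|l| <= 1 -> D (l *: z).

Definition complete_pseudoconvex_Reinhardt D :=
  [/\ domain D, pseudoconvex D, multicircular D & balanced D].

End Reinhardt.

(* Main.v *)
Require Import Defs.
From HB Require Import structures.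
From mathcomp Require Import all_boot all_order all_algebra.
From mathcomp Require Import all_classical all_reals all_analysis.
From mathcomp Require Import complex.
From mathcomp Require Import measurable_realfun ring lra.

Set Implicit Arguments.
Unset Strict Implicit.
Unset Printing Implicit Defensive.

Import Order.TTheory GRing.Theory Num.Theory.
Import numFieldNormedType.Exports.

Local Open Scope classical_set_scope.
Local Open Scope ring_scope.

(** Each of the three inequalities compares suprema over nested classes.  For a
function continuous up to the boundary [ustar] is at most the boundary value, and
the other upper limits are taken along smaller and smaller sets: [ustar] over [D],
[usharp] over approach regions, and the last one over the normal, which lies in
every approach region ([inward_normal_approach]).  It remains to close the
circle with [omega3 <= omega1] ([omega3_le_omega1]).

Let [u <= 0] be plurisubharmonic with upper limit at most [-1] along the normal
at each point of [K], let [f = max (u, -1)], and fix [xi] in [K] and points [z_m]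
of [D] tending to [xi] along the normal.  The torus maps the normal at [xi] to the
normal at the rotated point, so [f (e^(i theta) z_m)] tends to [-1] for every
[theta].  This information propagates from the torus to the open polydisc, one
coordinate at a time.  In one variable the statement is a two-constants theorem
([two_constants]): if functions with the sub-mean value property, bounded above
by [0], tend to [-1] at each point of the unit circle, then they do so uniformly
on smaller discs.  Indeed the exceptional arcs have small measure; they are
covered by finitely many intervals of small total length, and a suitably
normalised Poisson kernel, with its pole just outside the circle, dominates the
function on each interval, while on a smaller disc it is at most a constant
times the length.  The maximum principle ([disc_max_principle]) concludes.

Since no coordinate of [xi] vanishes, a point [w xi] with [|w_j| <= r < 1] can be
written [w_m z_m] with [|w_m| <= s < 1], hence [f = -1] on the open polydisc
spanned by [xi] ([boundary_to_polydisc]).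

Now let [F z] be the maximum of [f (w z)] over the closed unit polydisc
([polydisc_max]).  It makes sense because a balanced pseudoconvex Reinhardt
domain contains [w z] together with [z] ([complete_had]); it is plurisubharmonic,
at least [f], bounded above by [0], and equal to [-1] at [r xi] for [r < 1].  It is
also continuous: upper semicontinuity is compactness of the polydisc, and lower
semicontinuity follows from monotonicity in the moduli of the coordinates
together with [f p <= sup_(|l| < 1) f (l p)] ([psh_radial]).  Therefore the
dilates [z |-> F (r z)] are competitors for [omega1]; letting [r] tend to [1]
gives [u <= F <= omega1] on [D]. *)

(** * Circle means with explicit primitives *)

(** Pointwise forms of the differentiation rules, which compose as terms. *)
Section DerivePointwise.
Context {R : realType}.
Implicit Types (f g : R -> R) (x a b : R).

Lemma der_add f g x a b : is_derive x 1 f a -> is_derive x 1 g b ->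
  is_derive x 1 (fun y => f y + g y) (a + b).
Proof. exact: is_deriveD. Qed.

Lemma der_opp f x a : is_derive x 1 f a -> is_derive x 1 (fun y => - f y) (- a).
Proof. exact: is_deriveN. Qed.

Lemma der_mul f g x a b : is_derive x 1 f a -> is_derive x 1 g b ->
  is_derive x 1 (fun y => f y * g y) (f x * b + g x * a).
Proof. exact: is_deriveM. Qed.

Lemma der_scale c f x a : is_derive x 1 f a -> is_derive x 1 (fun y => c * f y) (c * a).
Proof. exact: is_deriveZ. Qed.

Lemma der_const c x : is_derive x 1 (fun=> c : R) 0.
Proof. exact: is_derive_cst. Qed.

Lemma der_id x : is_derive x 1 (fun y => y) 1.
Proof. exact: is_derive_id. Qed.

Lemma der_comp f g x a b : is_derive x 1 g b -> is_derive (g x) 1 f a ->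
  is_derive x 1 (fun y => f (g y)) (b * a).
Proof. by move=> dg df; have := is_derive1_comp df dg; rewrite mulrC. Qed.

Lemma der_inv f x a : f x != 0 -> is_derive x 1 f a ->
  is_derive x 1 (fun y => (f y)^-1) (- (f x) ^- 2 * a).
Proof. by move=> fx0 df; have := is_deriveV fx0 df. Qed.

End DerivePointwise.

Section Mean.
Context {R : realType}.
Local Notation mu := (@lebesgue_measure R).
Implicit Types (f g : R -> R) (m : R).

(** Both suprema over simple functions that define the integral are monotone in the
integrand, so a comparison can be made before anything is known about the
measurability of a plurisubharmonic function along a circle. *)
Lemma integral_mono (D : set R) (f g : R -> \bar R) :
  (forall x, D x -> (f x <= g x)%E) ->
  (\int[mu]_(x in D) f x <= \int[mu]_(x in D) g x)%E.
Proof.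
move=> fg.
have pat x : ((f \_ D) x <= (g \_ D) x)%E.
  by rewrite !patchE; case: ifPn => // /set_mem /fg.
rewrite /integral; apply: leeB; apply: ereal_sup_le => _ [h /= hf <-];
  exists h => // x; apply: le_trans (hf x) _.
- by rewrite !funeposE ge_max !le_max pat /= lexx orbT.
- by rewrite !funenegE ge_max !le_max leeN2 pat /= lexx orbT.
Qed.

(** A witness, through a primitive, that the average of [f] over [[0, 2 pi]] is [m].
All the means below are exact, and primitives add up where integrals would ask
for integrability each time. *)
Definition has_mean f m :=
  exists2 F : R -> R, forall t : R, is_derive t 1 F (f t) &
    F (2 * pi) - F 0 = 2 * pi * m.

Lemma integral_has_mean f m : continuous f -> has_mean f m ->
  (\int[mu]_(t in `[0%R, (2 * pi)%R]) (f t)%:E = (2 * pi * m)%:E)%E.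
Proof.
move=> cf [F dF <-].
have p0 : 0 < 2 * pi :> R by rewrite mulr_gt0 // pi_gt0.
rewrite (@continuous_FTC2 _ f F) //.
- exact: continuous_subspaceT.
- have cF (t : R) : {for t, continuous F}.
    by apply: differentiable_continuous; apply/derivable1_diffP; exact: ex_derive.
  split; first by move=> t _; exact: ex_derive.
  + exact/cvg_at_right_filter/cF.
  + exact/cvg_at_left_filter/cF.
- by move=> t _; rewrite derive1E derive_val.
Qed.

Lemma has_mean_cst m : has_mean (fun=> m) m.
Proof.
exists (fun t => m * t).
  by move=> t; apply: is_derive_eq (der_scale _ (der_id t)) _; rewrite mulr1.
by rewrite mulr0 subr0 mulrC.
Qed.

Lemma has_meanD f g m k :
  has_mean f m -> has_mean g k -> has_mean (fun t => f t + g t) (m + k).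
Proof.
move=> [F dF eF] [G dG eG]; exists (fun t => F t + G t).
  by move=> t; exact: der_add.
have -> : 2 * pi * (m + k) = 2 * pi * m + 2 * pi * k by ring.
by rewrite -eF -eG; ring.
Qed.

Lemma has_meanZ c f m : has_mean f m -> has_mean (fun t => c * f t) (c * m).
Proof.
move=> [F dF eF]; exists (fun t => c * F t).
  by move=> t; exact: der_scale.
have -> : 2 * pi * (c * m) = c * (2 * pi * m) by ring.
by rewrite -eF; ring.
Qed.

Lemma sin2pi0 : sin (2 * pi) = 0 :> R.
Proof. by rewrite mulr_natl sin2pi. Qed.

Lemma cos2pi1 : cos (2 * pi) = 1 :> R.
Proof. by rewrite mulr_natl cos2pi. Qed.

Lemma has_mean_cos : has_mean (@cos R) 0.
Proof.
exists (@sin R) => [t|]; first exact: is_derive_sin.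
by rewrite sin2pi0 sin0 mulr0 subr0.
Qed.

Lemma has_mean_sin : has_mean (@sin R) 0.
Proof.
exists (fun t => - cos t).
  move=> t; by apply: is_derive_eq (der_opp (is_derive_cos t)) _; rewrite opprK.
by rewrite cos2pi1 cos0 mulr0; ring.
Qed.

Lemma has_mean_cos2 : has_mean (fun t : R => cos t ^+ 2) (2^-1).
Proof.
exists (fun t => 2^-1 * (t + sin t * cos t)).
  move=> t; apply: is_derive_eq (der_scale _ (der_add (der_id t)
    (der_mul (is_derive_sin t) (is_derive_cos t)))) _.
  transitivity (2^-1 * ((cos t ^+ 2 + sin t ^+ 2) +
    (sin t * - sin t + cos t * cos t)) : R); last by field.
  by rewrite cos2Dsin2.
by rewrite sin2pi0 sin0; ring.
Qed.

(** The mean value property of the harmonic function [Re (1 / b)] on a circle of radius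
[s] about [b = be + i ga] lying in the right half-plane: with [X + i Y] on the circle,
the argument [atan (Y / X)] and [ln (X ^+ 2 + Y ^+ 2) / 2] are the two parts of a
logarithm, and the primitive is [t Re (1 / b)] minus [Im (log (X + i Y) / b)].  The
angle with cosine [c0] and sine [s0] rotates the parametrisation. *)
Lemma has_mean_re_inv (be ga s c0 s0 : R) : c0 ^+ 2 + s0 ^+ 2 = 1 -> 0 <= s < be ->
  has_mean (fun t => (be - s * (cos t * c0 + sin t * s0)) /
     ((be - s * (cos t * c0 + sin t * s0)) ^+ 2 +
      (ga + s * (cos t * s0 - sin t * c0)) ^+ 2))
   (be / (be ^+ 2 + ga ^+ 2)).
Proof.
move=> cs /andP[s0' sbe].
pose X t := be - s * (cos t * c0 + sin t * s0).
pose Y t := ga + s * (cos t * s0 - sin t * c0).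
have X_gt0 t : 0 < X t.
  have := cos2Dsin2 t => cs'.
  have : cos t * c0 + sin t * s0 <= 1.
    have := sqr_ge0 (cos t - c0); have := sqr_ge0 (sin t - s0); nra.
  rewrite /X; nra.
have dX (t : R) : is_derive t 1 X (ga - Y t).
  apply: is_derive_eq (der_add (der_const _ _) (der_opp (der_scale _ (der_add
    (der_mul (is_derive_cos t) (der_const _ _))
    (der_mul (is_derive_sin t) (der_const _ _)))))) _.
  by rewrite /Y; ring.
have dY (t : R) : is_derive t 1 Y (X t - be).
  apply: is_derive_eq (der_add (der_const _ _) (der_scale _ (der_add
    (der_mul (is_derive_cos t) (der_const _ _))
    (der_opp (der_mul (is_derive_sin t) (der_const _ _)))))) _.
  by rewrite /X; ring.
have be0 : 0 < be ^+ 2 + ga ^+ 2 by nra.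
set N := be ^+ 2 + ga ^+ 2 in be0 *.
have X2Y2 t : 0 < X t ^+ 2 + Y t ^+ 2 by have := X_gt0 t; nra.
exists (fun t => be / N * t + (- (be / N) * atan (Y t / X t) +
                 ga / (2 * N) * ln (X t * X t + Y t * Y t))).
  have Xn0 t : X t != 0 by rewrite gt_eqF.
  move=> t; apply: is_derive_eq (der_add (der_scale _ (der_id _)) (der_add
    (der_scale _ (der_comp (der_mul (dY t) (der_inv (Xn0 t) (dX t)))
      (is_derive1_atan _)))
    (der_scale _ (der_comp (der_add (der_mul (dX t) (dX t)) (der_mul (dY t) (dY t)))
      (is_derive1_ln (X2Y2 t)))))) _.
  have := X_gt0 t; have := X2Y2 t; rewrite -/(X t) -/(Y t).
  move: (X t) (Y t) => x y xy x0.
  rewrite /N in be0 *; field.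
  by rewrite (gt_eqF xy) (gt_eqF x0) (gt_eqF be0).
by rewrite /X /Y sin2pi0 cos2pi1 sin0 cos0; field; rewrite gt_eqF.
Qed.

End Mean.

(** * Upper semicontinuity and the maximum principle on the disc *)

Lemma near_prodI (T U : Type) (F : set_system T) (G : set_system U)
    (P : set T) (Q : set U) (S : T -> U -> Prop) :
  F P -> G Q -> (forall x y, P x -> Q y -> S x y) ->
  \forall x \near F & y \near G, S x y.
Proof. by move=> FP GQ h; exists (P, Q) => //= -[x y] [] /=; exact: h. Qed.

(** If the supremum were not attained, each point would have a neighbourhood on which
[f] stays below some value smaller than it; compactness makes this value uniform.
The same argument with [+oo] in place of the supremum bounds [f] above. *)
Lemma usc_compact_max {R : realType} (T : topologicalType) (A : set T) (f : T -> R) :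
  compact A -> A !=set0 ->
  (forall x a, A x -> f x < a -> \forall y \near x, A y -> f y < a) ->
  exists2 x, A x & forall y, A y -> f y <= f x.
Proof.
move=> /compact_near_coveringP/near_covering_withinP cA [x0 Ax0] uf.
have [M AM] : exists M, A `<=` (fun x => f x < M).
  apply: (@filter_ex _ (+oo : set_system R)).
  have := cA R (pinfty_nbhs R) (fun i x => f x < i) _; apply => x Ax.
  have fx : f x < f x + 1 by rewrite ltrDl.
  apply: near_prodI (uf _ _ Ax fx) (nbhs_pinfty_ge (num_real (f x + 1))) _.
  by move=> y i fy /= fi /fy fy'; exact: lt_le_trans fy' fi.
have sA : has_sup (f @` A).
  split; first by exists (f x0); exists x0.
  by exists M => _ [x Ax <-]; exact/ltW/AM.
have ubA x : A x -> f x <= sup (f @` A).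
  by move=> Ax; apply: (sup_upper_bound sA); exists x.
have [//|noM] := pselect (exists2 x, A x & forall y, A y -> f y <= f x).
have ltM x : A x -> f x < sup (f @` A).
  move=> Ax; rewrite lt_neqAle ubA // andbT; apply/eqP => fx.
  by apply: noM; exists x => // y Ay; rewrite fx; exact: ubA.
suff [i [iM Ai]] : exists i, i < sup (f @` A) /\ A `<=` (fun x => f x < i).
  have : sup (f @` A) <= i.
    apply: ge_sup; first by exists (f x0); exists x0.
    by move=> _ [x Ax <-]; exact/ltW/Ai.
  by rewrite leNgt iM.
apply: (@filter_ex _ ((sup (f @` A))^'-)).
apply: filterI; first exact: nbhs_left_lt.
have := cA R (at_left (sup (f @` A))) (fun i x => f x < i) _; apply => x Ax.
have := ltM _ Ax => /midf_lt [/uf fxm mM].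
apply: near_prodI (fxm Ax) (nbhs_left_ge mM) _.
by move=> y i fy /= fi /fy fy'; exact: lt_le_trans fy' fi.
Qed.

Section Disc.
Context {R : realType}.
Implicit Types (g q : R * R -> R) (x y s : R) (p : R * R).
Local Notation mu := (@lebesgue_measure R).

Lemma cvg_sqr (T : Type) (F : set_system T) (FF : Filter F) (f : T -> R) (l : R) :
  f @ F --> l -> (fun z => f z ^+ 2) @ F --> l ^+ 2.
Proof. by move=> h; exact: (cvgM h h). Qed.

(** The one-variable theory is written in real coordinates, where compactness and
continuity come from the product topology of [R * R]. *)
Definition disc : set (R * R) := [set p | p.1 ^+ 2 + p.2 ^+ 2 <= 1].

Lemma compact_disc : compact disc.
Proof.
apply: (@subclosed_compact (R * R)%type disc (`[-1, 1]%classic `*` `[-1, 1]%classic)).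
- have -> : disc = (fun p => p.1 ^+ 2 + p.2 ^+ 2) @^-1` [set x | x <= 1] by [].
  apply: preimage_closed; last exact: closed_le.
  move=> p _ /=; apply: cvgD; apply: cvg_sqr; [exact: cvg_fst|exact: cvg_snd].
- by apply: compact_setX; exact: segment_compact.
- move=> [x y] /= xy; rewrite !in_itv /= -!ler_norml -!(@ler_sqr _ _ 1) ?nnegrE //.
  rewrite !real_normK ?num_real // expr1n; move: xy; rewrite /disc /=.
  by have := sqr_ge0 x; have := sqr_ge0 y; lra.
Qed.

Lemma unit_circle_polar x y : x ^+ 2 + y ^+ 2 = 1 ->
  exists2 t, t \in `[0, 2 * pi] & x = cos t /\ y = sin t.
Proof.
move=> xy1.
have x1 : -1 <= x <= 1.
  by rewrite -ler_norml -(@ler_sqr _ _ 1) ?nnegrE // real_normK ?num_real //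
    expr1n -xy1 lerDl sqr_ge0.
have x2 : 1 - x ^+ 2 = y ^+ 2 by rewrite -xy1 addrC addKr.
have := acos_ge0 x1; have := acos_lepi x1 => acpi ac0.
have pi0 : 0 < pi :> R := pi_gt0 R.
have [y0|y0] := leP 0 y.
  exists (acos x); first by rewrite in_itv /= ac0 /=; lra.
  by rewrite acosK ?sin_acos // x2 sqrtr_sqr ger0_norm.
exists (2 * pi - acos x); first by rewrite in_itv /=; apply/andP; split; lra.
rewrite cosB sinB sin2pi0 cos2pi1 !mul0r !mul1r addr0 sub0r acosK ?sin_acos //.
by rewrite x2 sqrtr_sqr ltr0_norm // opprK.
Qed.

Definition circle x y s (t : R) : R * R := (x + s * cos t, y + s * sin t).

Lemma continuous_circle x y s : continuous (circle x y s).
Proof.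
move=> t; apply: (@cvg_pair _ _ _ (nbhs t) (nbhs (x + s * cos t))
  (nbhs (y + s * sin t)) _ _ _ (fun t => x + s * cos t) (fun t => y + s * sin t)).
  apply: cvgD; first exact: cvg_cst.
  by apply: cvgM; [exact: cvg_cst|exact: continuous_cos].
apply: cvgD; first exact: cvg_cst.
by apply: cvgM; [exact: cvg_cst|exact: continuous_sin].
Qed.

(** The closed disc of centre [(x, y)] and radius [s] lies in the closed unit disc. *)
Definition circle_in x y s := 0 < s /\ Num.sqrt (x ^+ 2 + y ^+ 2) + s <= 1.

Lemma circle_in_disc x y s a b : circle_in x y s -> a ^+ 2 + b ^+ 2 <= 1 ->
  disc (x + s * a, y + s * b).
Proof.
move=> [s0 rs1] ab; rewrite /disc /=.
set r := Num.sqrt _ in rs1.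
have r0 : 0 <= r by exact: sqrtr_ge0.
have r2 : r ^+ 2 = x ^+ 2 + y ^+ 2 by rewrite sqr_sqrtr // addr_ge0 ?sqr_ge0.
have xayb : x * a + y * b <= r.
  rewrite real_leNgt ?num_real //; apply/negP => lt.
  have : r ^+ 2 < (x * a + y * b) ^+ 2 by rewrite ltr_pXn2r ?nnegrE ?(le_trans r0 (ltW lt)).
  rewrite r2 => h.
  have := sqr_ge0 (x * b - y * a).
  have := mulr_ge0 (addr_ge0 (sqr_ge0 x) (sqr_ge0 y)) (_ : 0 <= 1 - (a ^+ 2 + b ^+ 2)).
  by rewrite subr_ge0 => /(_ ab); nra.
have rs2 : (r + s) ^+ 2 <= 1 by rewrite expr_le1 // addr_ge0 // ltW.
have : s * (x * a + y * b) <= s * r by rewrite ler_pM2l.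
have : s ^+ 2 * (a ^+ 2 + b ^+ 2) <= s ^+ 2 by rewrite ler_piMr // sqr_ge0.
nra.
Qed.

Definition usc_disc g := forall p a, disc p -> g p < a ->
  \forall p' \near p, disc p' -> g p' < a.

Definition submean g := forall x y s, circle_in x y s ->
  ((g (x, y))%:E <= (2 * pi)^-1%:E *
     \int[mu]_(t in `[0%R, (2 * pi)%R]) (g (circle x y s t))%:E)%E.

Definition exact_mean q := forall x y s, circle_in x y s ->
  has_mean (fun t => q (circle x y s t)) (q (x, y)).

(** Adding [eta |p|^2] to [g - q] makes the sub-mean value inequality strict by
[eta s^2] on a circle of radius [s].  The perturbed function is upper
semicontinuous, so it attains its maximum, which can then only be on the unit
circle; [eta] is arbitrary. *)
Lemma disc_max_principle g q : usc_disc g -> submean g ->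
  (forall p, disc p -> {for p, continuous q}) -> exact_mean q ->
  (forall t, g (cos t, sin t) <= q (cos t, sin t)) ->
  forall p, disc p -> g p <= q p.
Proof.
move=> ug sg cq mq gq p dp; apply/ler_addgt0Pr => eta eta0.
pose h p := g p - q p + eta * (p.1 ^+ 2 + p.2 ^+ 2).
have [|[x0 y0] dp0 maxp0] := @usc_compact_max R _ disc h compact_disc (ex_intro _ p dp).
  move=> z a dz hz.
  pose e := (a - h z) / 2.
  have e0 : 0 < e by rewrite divr_gt0 // subr_gt0.
  have ge : g z < g z + e by rewrite ltrDl.
  have := ug z _ dz ge.
  have c2 : {for z, continuous (fun p => q p - eta * (p.1 ^+ 2 + p.2 ^+ 2))}.
    apply: cvgB; first exact: cq.
    apply: cvgM; first exact: cvg_cst.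
    apply: cvgD; apply: cvg_sqr; [exact: cvg_fst|exact: cvg_snd].
  move/cvgrPdist_lt: c2 => /(_ _ e0).
  apply: filterS2 => z' /=; rewrite /h => qz gz' /gz'.
  move: qz; rewrite ltr_norml => /andP[_]; rewrite /e /h; lra.
(* The maximum is either on the circle, where g <= q, or leads to a contradiction. *)
suff hp0 : h (x0, y0) <= eta.
  have := le_trans (maxp0 _ dp) hp0; rewrite /h.
  have := mulr_ge0 (ltW eta0) (addr_ge0 (sqr_ge0 p.1) (sqr_ge0 p.2)); lra.
set r := Num.sqrt (x0 ^+ 2 + y0 ^+ 2).
have r2 : r ^+ 2 = x0 ^+ 2 + y0 ^+ 2 by rewrite sqr_sqrtr // addr_ge0 ?sqr_ge0.
have r0 : 0 <= r by exact: sqrtr_ge0.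
have : r <= 1.
  by rewrite -(@ler_pXn2r _ 2) ?nnegrE // expr1n r2.
rewrite le_eqVlt => /predU1P[r1|r1].
  have [t [-> ->]] : exists t, x0 = cos t /\ y0 = sin t.
    by have [|t _] := @unit_circle_polar x0 y0; [rewrite -r2 r1 expr1n|exists t].
  rewrite /h /= cos2Dsin2 mulr1; have := gq t; lra.
exfalso.
pose s := 1 - r.
have cin : circle_in x0 y0 s by split; rewrite /s ?subr_gt0 // -/r; lra.
have := sg _ _ _ cin.
apply/negP; rewrite -ltNge.
pose M := h (x0, y0).
pose Q t := M + q (circle x0 y0 s t) - eta * 
  ((circle x0 y0 s t).1 ^+ 2 + (circle x0 y0 s t).2 ^+ 2).
have dC t : disc (circle x0 y0 s t) by apply: circle_in_disc; rewrite ?cos2Dsin2.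
have le_gQ t : g (circle x0 y0 s t) <= Q t.
  by have := maxp0 _ (dC t); rewrite /Q -/M /h; lra.
have mQ : has_mean Q (M + q (x0, y0) - eta * (r ^+ 2 + s ^+ 2)).
  have := has_meanD (has_mean_cst M) (has_meanD (mq _ _ _ cin)
    (has_meanD (has_mean_cst (- eta * (r ^+ 2 + s ^+ 2)))
    (has_meanD (has_meanZ (- 2 * eta * s * x0) has_mean_cos)
               (has_meanZ (- 2 * eta * s * y0) has_mean_sin)))).
  congr has_mean; last by ring.
  apply/funext => t; rewrite /Q /circle /= r2.
  have := cos2Dsin2 t => cs.
  have -> : s ^+ 2 = s ^+ 2 * (cos t ^+ 2 + sin t ^+ 2) by rewrite cs mulr1.
  by ring.
have cQ : continuous Q.
  move=> t; apply: cvgB.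
    apply: cvgD; first exact: cvg_cst.
    by apply: (continuous_comp (@continuous_circle x0 y0 s t)); exact: cq.
  apply: cvgM; first exact: cvg_cst.
  by apply: cvgD; apply: cvg_sqr; apply: (continuous_comp (@continuous_circle x0 y0 s t));
    [exact: cvg_fst|exact: cvg_snd].
have -> : (g (x0, y0))%:E = (M + q (x0, y0) - eta * (r ^+ 2 + s ^+ 2) + eta * s ^+ 2)%:E.
  by congr EFin; rewrite /M /h /= -r2; ring.
have p20 : 0 < 2 * pi :> R by rewrite mulr_gt0 // pi_gt0.
apply: (@le_lt_trans _ _ ((2 * pi)^-1%:E * \int[mu]_(t in `[0%R, (2 * pi)%R]) (Q t)%:E)%E).
  rewrite lee_pmul2l // ?lte_fin ?invr_gt0 //.
  by apply: integral_mono => t _; rewrite lee_fin.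
rewrite (integral_has_mean cQ mQ) -EFinM lte_fin mulrA mulVf ?gt_eqF // mul1r.
by rewrite ltrDl mulr_gt0 // exprn_gt0 //; case: cin.
Qed.

End Disc.

(** * Harmonic barriers and the two-constants theorem *)

Section Barrier.
Context {R : realType}.
Implicit Types (g q : R * R -> R) (x y s : R) (p : R * R).
Local Notation mu := (@lebesgue_measure R).

Lemma ge0_of_deriv (f df : R -> R) (u : R) : (forall x : R, is_derive x 1 f (df x)) ->
  (forall x, 0 <= x -> 0 <= df x) -> f 0 = 0 -> 0 <= u -> 0 <= f u.
Proof.
move=> dfP df0 f0 u0.
have cf : {within `[0, u], continuous f}.
  apply: continuous_subspaceT => x.
  by apply: differentiable_continuous; apply/derivable1_diffP; exact: ex_derive.
have [c] := MVT_segment u0 (fun x _ => dfP x) cf.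
rewrite in_itv /= f0 !subr0 => /andP[c0 _] ->.
by rewrite mulr_ge0 // df0.
Qed.

Lemma one_minus_cos_le (u : R) : 1 - cos u <= u ^+ 2 / 2.
Proof.
wlog u0 : u / 0 <= u.
  move=> h; have [/h//|/ltW u0] := leP 0 u.
  by rewrite -cosN -sqrrN; apply: h; rewrite oppr_ge0.
have sin_le (v : R) : 0 <= v -> 0 <= v - sin v.
  apply: (@ge0_of_deriv (fun v => v - sin v) (fun v => 1 - cos v)).
  - by move=> x _; rewrite subr_ge0 cos_le1.
  - by rewrite sin0 subr0.
rewrite -subr_ge0.
apply: (@ge0_of_deriv (fun v => v ^+ 2 / 2 - (1 - cos v)) (fun v => v - sin v)) => //.
  move=> x; have := der_add
    (der_mul (der_mul (der_id x) (der_id x)) (der_const (2^-1) x))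
    (der_opp (der_add (der_const 1 x) (der_opp (is_derive_cos x)))).
  by move/is_derive_eq; apply; field.
by rewrite cos0 subrr expr0n /= mul0r subr0.
Qed.

(** For an interval of length [l = b - a] and midpoint [m], these are the real and
imaginary parts of [1 + l - p e^(- i m)], the distance vector from [p] to a pole
[(1 + l) e^(i m)] outside the unit disc, rotated to the positive axis. *)
Definition pole_re (a b : R) p :=
  (1 + (b - a)) - (p.1 * cos ((a + b) / 2) + p.2 * sin ((a + b) / 2)).
Definition pole_im (a b : R) p := p.1 * sin ((a + b) / 2) - p.2 * cos ((a + b) / 2).
(** The Poisson kernel with pole [(1 + l) e^(i m)], multiplied by [l]: the pole is at
distance [l] from the circle, so the kernel is of order [1 / l] on the arc and
bounded on smaller discs; compare [barrier_ge1] and [barrier_le]. *)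
Definition barrier (a b : R) p :=
  (b - a) * (2 * (1 + (b - a)) *
    (pole_re a b p / (pole_re a b p ^+ 2 + pole_im a b p ^+ 2)) - 1).

(** The projection of [p] on a unit vector is at most [|p|]. *)
Lemma pole_re_ge (a b r : R) p : 0 <= r -> p.1 ^+ 2 + p.2 ^+ 2 <= r ^+ 2 ->
  1 + (b - a) - r <= pole_re a b p.
Proof.
move=> r0 pr; rewrite /pole_re lerD2l lerN2.
set c := cos _; set s := sin _.
have cs : c ^+ 2 + s ^+ 2 = 1 by exact: cos2Dsin2.
rewrite real_leNgt ?num_real //; apply/negP => lt.
have : r ^+ 2 < (p.1 * c + p.2 * s) ^+ 2.
  by rewrite ltr_pXn2r ?nnegrE ?(le_trans r0 (ltW lt)).
have -> : (p.1 * c + p.2 * s) ^+ 2 =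
  (p.1 ^+ 2 + p.2 ^+ 2) * (c ^+ 2 + s ^+ 2) - (p.1 * s - p.2 * c) ^+ 2 by ring.
by rewrite cs; have := sqr_ge0 (p.1 * s - p.2 * c); lra.
Qed.

Lemma pole_sqrE (a b : R) p : pole_re a b p ^+ 2 + pole_im a b p ^+ 2 =
  2 * (1 + (b - a)) * pole_re a b p - (1 + (b - a)) ^+ 2 + (p.1 ^+ 2 + p.2 ^+ 2).
Proof.
rewrite /pole_re /pole_im; set c := cos _; set s := sin _.
have cs : c ^+ 2 + s ^+ 2 = 1 by exact: cos2Dsin2.
have -> : p.1 ^+ 2 + p.2 ^+ 2 = (p.1 ^+ 2 + p.2 ^+ 2) * (c ^+ 2 + s ^+ 2).
  by rewrite cs mulr1.
by ring.
Qed.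

Section Interval.
Variables (a b : R).
Hypothesis ab : a < b.
Let l := b - a.
Let l0 : 0 < l. Proof. by rewrite subr_gt0. Qed.

Lemma pole_re_gt0 p : disc p -> 0 < pole_re a b p.
Proof.
move=> dp; have := @pole_re_ge a b 1 p ler01; rewrite expr1n => /(_ dp).
by move: l0; rewrite /l; lra.
Qed.

Lemma pole_sqr_gt0 p : disc p -> 0 < pole_re a b p ^+ 2 + pole_im a b p ^+ 2.
Proof. by move=> /pole_re_gt0 X0; rewrite ltr_wpDr ?sqr_ge0 // exprn_gt0. Qed.

(** The usual form [(rho^2 - |p|^2) / |rho - p|^2] of the Poisson kernel, from which
the estimates are read off. *)
Lemma barrierE p : disc p -> barrier a b p =
  l * (((1 + l) ^+ 2 - (p.1 ^+ 2 + p.2 ^+ 2)) / (pole_re a b p ^+ 2 + pole_im a b p ^+ 2)).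
Proof.
move=> dp; rewrite /barrier -/l; congr (_ * _).
have := pole_sqrE a b p; rewrite -/l; have := pole_sqr_gt0 dp.
set N := pole_re _ _ _ ^+ 2 + _ => N0 eN.
have -> : (1 + l) ^+ 2 - (p.1 ^+ 2 + p.2 ^+ 2) = 2 * (1 + l) * pole_re a b p - N.
  by rewrite eN; ring.
by field; rewrite gt_eqF.
Qed.

Lemma barrier_ge0 p : disc p -> 0 <= barrier a b p.
Proof.
move=> dp; rewrite barrierE //; apply: mulr_ge0; first exact: ltW.
apply: divr_ge0; last exact/ltW/pole_sqr_gt0.
by move: dp l0; rewrite /disc /=; nra.
Qed.

Lemma barrier_continuous p : disc p -> {for p, continuous (barrier a b)}.
Proof.
move=> dp.
have cX : pole_re a b p' @[p' --> p] --> pole_re a b p.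
  apply: cvgB; first exact: cvg_cst.
  by apply: cvgD; apply: cvgM; [exact: cvg_fst|exact: cvg_cst|exact: cvg_snd|exact: cvg_cst].
have cY : pole_im a b p' @[p' --> p] --> pole_im a b p.
  by apply: cvgB; apply: cvgM; [exact: cvg_fst|exact: cvg_cst|exact: cvg_snd|exact: cvg_cst].
apply: cvgM; first exact: cvg_cst.
apply: cvgB; last exact: cvg_cst.
apply: cvgM; first exact: cvg_cst.
apply: cvgM; first exact: cX.
apply: cvgV; first by rewrite gt_eqF // pole_sqr_gt0.
by apply: cvgD; apply: cvg_sqr.
Qed.

Lemma barrier_exact : exact_mean (barrier a b).
Proof.
move=> x y s [s0 rs].
set c0 := cos ((a + b) / 2); set s0' := sin ((a + b) / 2).
have cs : c0 ^+ 2 + s0' ^+ 2 = 1 by exact: cos2Dsin2.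
have sX : 0 <= s < pole_re a b (x, y).
  rewrite (ltW s0) /=.
  have := @pole_re_ge a b (Num.sqrt (x ^+ 2 + y ^+ 2)) (x, y) (sqrtr_ge0 _).
  rewrite sqr_sqrtr ?addr_ge0 ?sqr_ge0 // lexx => /(_ isT).
  by move: l0 rs; rewrite /l; lra.
have := has_meanZ l (has_meanD (has_meanZ (2 * (1 + l))
  (has_mean_re_inv (pole_im a b (x, y)) cs sX)) (has_mean_cst (-1))).
congr has_mean; apply/funext => t; rewrite /barrier -/l; congr (_ * (_ * (_ / _) - _)).
- by rewrite /pole_re /= -/c0 -/s0'; ring.
- by rewrite /pole_re /pole_im /= -/c0 -/s0'; ring.
Qed.

Lemma barrier_le r p : 0 <= r < 1 -> p.1 ^+ 2 + p.2 ^+ 2 <= r ^+ 2 ->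
  barrier a b p <= l / (1 - r) ^+ 2.
Proof.
move=> /andP[r0 r1] pr.
have dp : disc p by apply: le_trans pr _; rewrite expr_le1 // ltW.
rewrite barrierE // ler_pM2l // ler_pdivrMr ?pole_sqr_gt0 //.
have lr : 0 < 1 + l - r by move: l0; lra.
have X2 : (1 + l - r) ^+ 2 <= pole_re a b p ^+ 2 + pole_im a b p ^+ 2.
  apply: le_trans (_ : pole_re a b p ^+ 2 <= _); last by rewrite lerDl sqr_ge0.
  have := pole_re_ge a b r0 pr; rewrite -/l => h.
  by rewrite ler_pXn2r ?nnegrE // ?(le_trans (ltW lr) h) // ltW.
have q0 : 0 < (1 - r) ^+ 2 by rewrite exprn_gt0 // subr_gt0.
rewrite mulrC ler_pdivlMr //.
apply: (@le_trans _ _ ((1 + l) ^+ 2 * (1 - r) ^+ 2)).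
  by rewrite ler_pM2r // gerBl addr_ge0 // sqr_ge0.
apply: le_trans X2; rewrite -exprMn ler_pXn2r ?nnegrE ?(ltW lr) //.
  by have := mulr_ge0 (ltW l0) r0; lra.
by rewrite mulr_ge0 //; move: l0; lra.
Qed.

(** On the arc the squared distance to the pole is
[l^2 + 2 (1 + l) (1 - cos (t - m))], at most [l^2 + (1 + l) l^2 / 4]. *)
Lemma barrier_ge1 t : a < t < b -> 1 <= barrier a b (cos t, sin t).
Proof.
move=> /andP[at_ tb].
have dp : disc (cos t, sin t) by rewrite /disc /= cos2Dsin2.
rewrite barrierE // mulrA ler_pdivlMr ?pole_sqr_gt0 // mul1r pole_sqrE -/l /= cos2Dsin2.
have -> : pole_re a b (cos t, sin t) = 1 + l - cos (t - (a + b) / 2) by rewrite /pole_re cosB.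
have := one_minus_cos_le (t - (a + b) / 2).
set c := cos _ => hc.
have h2 : (t - (a + b) / 2) ^+ 2 <= (l / 2) ^+ 2.
  rewrite -subr_ge0.
  have -> : (l / 2) ^+ 2 - (t - (a + b) / 2) ^+ 2 = (t - a) * (b - t).
    by rewrite /l; field.
  by rewrite mulr_ge0 // subr_ge0 ltW.
have : 1 - c <= l ^+ 2 / 8.
  by move: hc h2; rewrite expr_div_n; lra.
have := ltW l0; nra.
Qed.

End Interval.

Lemma has_mean_sum (I : Type) (r : seq I) (P : pred I) (f : I -> R -> R) (m : I -> R) :
  (forall i, P i -> has_mean (f i) (m i)) ->
  has_mean (fun t => \sum_(i <- r | P i) f i t) (\sum_(i <- r | P i) m i).
Proof.
move=> h; elim: r => [|i r IH].
  rewrite big_nil; under eq_fun do rewrite big_nil; exact: has_mean_cst.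
rewrite big_cons; under eq_fun do rewrite big_cons.
by case: ifPn => // Pi; apply: has_meanD => //; exact: h.
Qed.

Lemma cvg_bigsum (T I : Type) (F : set_system T) (FF : Filter F) (r : seq I)
    (P : pred I) (f : I -> T -> R) (m : I -> R) :
  (forall i, P i -> f i z @[z --> F] --> m i) ->
  (\sum_(i <- r | P i) f i z) @[z --> F] --> \sum_(i <- r | P i) m i.
Proof.
move=> h; elim: r => [|i r IH].
  rewrite big_nil; under eq_fun do rewrite big_nil; exact: cvg_cst.
rewrite big_cons; under eq_fun do rewrite big_cons.
by case: ifPn => // Pi; apply: cvgD => //; exact: h.
Qed.

(** Lebesgue measure is an outer measure computed with open intervals, and a compact
set needs only finitely many of them.  Empty intervals of the cover are dropped
from the sum. *)
Lemma compact_itv_cover (E : set R) (d : R) : compact E -> (mu E < d%:E)%E ->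
  exists (N : nat) (ab : nat -> R * R),
    (forall t, E t -> exists2 k, (k < N)%N & (ab k).1 < t < (ab k).2) /\
    \sum_(k < N | (ab k).1 < (ab k).2) ((ab k).2 - (ab k).1) <= d.
Proof.
move=> /compact_near_coveringP cE Ed.
have Efin : mu E \is a fin_num by rewrite ge0_fin_numE // (lt_trans Ed) ?ltry.
have eE : mu E = (((@wlength R idfun)^* )%mu E) by [].
have e0 : 0 < d - fine (mu E) by rewrite subr_gt0 -lte_fin fineK.
move: (Efin); rewrite {1}eE outer_measure_open_itv_cover => Efin'.
have [_ /= [F [oF EF] <-]] := lb_ereal_inf_adherent e0 Efin'.
rewrite -outer_measure_open_itv_cover -eE.
have -> : (mu E + (d - fine (mu E))%:E)%E = d%:E.
  by rewrite -{1}(fineK Efin) -EFinD addrC subrK.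
move=> Fd.
have [ab abF] : exists ab : nat -> R * R, forall k, F k = `](ab k).1, (ab k).2[%classic.
  by have /choice [ab h] : forall k, exists ab : R * R, F k = `]ab.1, ab.2[%classic
    by []; exists ab.
have [N EN] : exists N, E `<=` (fun t => exists2 k, (k < N)%N & (ab k).1 < t < (ab k).2).
  apply: (@filter_ex _ \oo).
  have := cE nat \oo (fun N t => exists2 k, (k < N)%N & (ab k).1 < t < (ab k).2) _.
  apply => t Et.
  have [k _] := EF _ Et; rewrite abF => kt.
  have kn : nbhs t `](ab k).1, (ab k).2[%classic by exact: near_in_itvoo.
  apply: near_prodI kn (nbhs_infty_gt k) _.
  by move=> x n /=; rewrite in_itv /= => xk lekn; exists k.
exists N, ab; split => //.
rewrite -lee_fin; apply: le_trans (ltW Fd).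
have -> : (\sum_(k < N | (ab k).1 < (ab k).2) ((ab k).2 - (ab k).1))%:E =
   (\sum_(0 <= k < N) wlength idfun (F k))%E.
  rewrite big_mkord big_mkcond /= -sumEFin; apply: eq_bigr => k _.
  by rewrite abF wlength_itv /= lte_fin; case: ifP.
apply: nneseries_lim_ge => k _ _; exact: wlength_ge0.
Qed.

(** On the circle [g] is dominated by the constant [-1 + c] plus the barriers of the
intervals covering [E]: off [E] by assumption, on [E] because one barrier is at
least [1] there while [g <= 0]. *)
Lemma bound_off_small_set g (E : set R) (c d r : R) :
  usc_disc g -> submean g -> (forall p, disc p -> g p <= 0) ->
  compact E -> (mu E < d%:E)%E -> 0 <= c ->
  (forall t, t \in `[0, 2 * pi] -> ~ E t -> g (cos t, sin t) <= -1 + c) ->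
  0 <= r < 1 ->
  forall p, p.1 ^+ 2 + p.2 ^+ 2 <= r ^+ 2 -> g p <= -1 + c + d / (1 - r) ^+ 2.
Proof.
move=> ug sg g0 cE Ed c0 gE r01 p pr.
have [N [ab [EN sN]]] := compact_itv_cover cE Ed.
have := r01 => /andP[r0 r1].
have dp : disc p by apply: le_trans pr _; rewrite expr_le1 // ltW.
pose q p := -1 + c + \sum_(k < N | (ab k).1 < (ab k).2) barrier (ab k).1 (ab k).2 p.
apply: (@le_trans _ _ (q p)); last first.
  rewrite lerD2l; apply: (@le_trans _ _ (\sum_(k < N | (ab k).1 < (ab k).2)
      ((ab k).2 - (ab k).1) / (1 - r) ^+ 2)).
    by apply: ler_sum => k abk; exact: barrier_le.
  by rewrite -mulr_suml ler_pM2r // invr_gt0 exprn_gt0 // subr_gt0.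
apply: disc_max_principle dp => //.
- move=> z dz; apply: cvgD; first exact: cvg_cst.
  by apply: cvg_bigsum => k abk; exact: barrier_continuous.
- move=> x y s cin; rewrite /q; apply: has_meanD; first exact: has_mean_cst.
  by apply: has_mean_sum => k abk; exact: barrier_exact.
- move=> t.
  have dt : disc (cos t, sin t) by rewrite /disc /= cos2Dsin2.
  have sum0 (P : pred 'I_N) : 0 <= \sum_(k < N | ((ab k).1 < (ab k).2) && P k)
      barrier (ab k).1 (ab k).2 (cos t, sin t).
    by apply: sumr_ge0 => k /andP[abk _]; exact: barrier_ge0.
  have [t' t'2 [ct st]] := unit_circle_polar (cos2Dsin2 t).
  have [Et|nEt] := pselect (E t'); last first.
    have := gE _ t'2 nEt; rewrite -ct -st => /le_trans; apply.
    rewrite /q lerDl; have := sum0 xpredT.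
    by under eq_bigl do rewrite andbT.
  apply: (le_trans (g0 _ dt)).
  have [k kN abk] := EN _ Et.
  have abk' : (ab k).1 < (ab k).2 by case/andP: abk => h1 h2; exact: lt_trans h1 h2.
  rewrite /q (bigD1 (Ordinal kN)) //=.
  have := sum0 (fun i => i != Ordinal kN).
  have := barrier_ge1 abk' abk; rewrite -ct -st.
  by move: c0; lra.
Qed.

(** Pointwise convergence on the circle makes the measure of the set where [g m] is
at least [-1 + c] for some later index tend to [0], since these sets decrease
to the empty set. *)
Lemma two_constants (g : nat -> R * R -> R) :
  (forall m, usc_disc (g m)) -> (forall m, submean (g m)) ->
  (forall m p, disc p -> g m p <= 0) ->
  (forall t e, 0 < e -> \forall m \near \oo, g m (cos t, sin t) < -1 + e) ->
  forall r e, 0 <= r < 1 -> 0 < e ->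
    \forall m \near \oo, forall p, p.1 ^+ 2 + p.2 ^+ 2 <= r ^+ 2 -> g m p < -1 + e.
Proof.
move=> ug sg g0 glim r e r01 e0.
have := r01 => /andP[r0 r1].
have q0 : 0 < (1 - r) ^+ 2 by rewrite exprn_gt0 // subr_gt0.
pose c := e / 3; have cp : 0 < c by rewrite divr_gt0.
pose E m := `[0, 2 * pi]%classic `&` ~` [set t | g m (cos t, sin t) < -1 + c].
have circleE (t : R) : circle 0 0 1 t = (cos t, sin t) by rewrite /circle !add0r !mul1r.
have oE m : open [set t | g m (cos t, sin t) < -1 + c].
  rewrite openE => t /= gt.
  have dt (u : R) : disc (cos u, sin u) by rewrite /disc /= cos2Dsin2.
  have := ug m _ _ (dt t) gt; rewrite -circleE => h.
  have := @continuous_circle R 0 0 1 t _ h.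
  rewrite /interior nbhs_filterE /=; apply: filterS => u /=; rewrite circleE; exact.
have clE m : closed (E m).
  by apply: closedI; [exact: interval_closed|exact: open_closedC].
have cE m : compact (E m).
  by apply: (subclosed_compact (clE m) (@segment_compact R 0 (2 * pi))) => t [].
(* F n collects the bad angles of all indices from n on. *)
pose F n := \bigcup_(m in [set m | (n <= m)%N]) E m.
have mE m : measurable (E m) by exact: closed_measurable.
have mF n : measurable (F n) by exact: bigcup_measurable.
have F0 : \bigcap_n F n = set0.
  rewrite -subset0 => t Ft.
  have [N _ hN] := glim t _ cp.
  by have [m /= Nm [_ /=]] := Ft N I; apply; exact: hN.
have p20 : 0 <= 2 * pi :> R by rewrite mulr_ge0 // pi_ge0.
have : mu \o F @ \oo --> mu (\bigcap_n F n).
  apply: nonincreasing_cvg_mu => //.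
  - apply: (@le_lt_trans _ _ (mu `[0, 2 * pi]%classic)).
      apply: le_measure; rewrite ?inE; [exact: mF|exact: measurable_itv|].
      by move=> t [m _ []].
    by rewrite lebesgue_measure_itv /=; case: ifP => _; rewrite ?ltry // -EFinB ltry.
  - by rewrite F0.
  - move=> n m nm; apply/subsetPset => t [k /= mk Ekt]; exists k => //=.
    exact: leq_trans mk.
rewrite F0 measure0 => muF.
(* So that d / (1 - r) ^+ 2 = c in bound_off_small_set. *)
pose d := c * (1 - r) ^+ 2; have d0 : 0 < d by rewrite mulr_gt0.
have [N _ hN] : \forall n \near \oo, (mu (F n) < d%:E)%E.
  have dnb : nbhs (0 : \bar R)%E [set y | (y < d%:E)%E].
    by apply: open_nbhs_nbhs; split; [exact: open_ereal_lt_ereal|rewrite /= lte_fin].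
  exact: (muF _ dnb).
exists N => // m /= Nm p pr.
have EF : (mu (E m) < d%:E)%E.
  apply: le_lt_trans (hN N (leqnn N)); apply: le_measure; rewrite ?inE;
    [exact: mE|exact: mF|].
  by move=> t Et; exists m.
have := bound_off_small_set (ug m) (sg m) (g0 m) (cE m) EF (ltW cp) _ r01 pr.
have gE t : t \in `[0, 2 * pi] -> ~ E m t -> g m (cos t, sin t) <= -1 + c.
  move=> t02 nE; apply/ltW; apply: contrapT => h; apply: nE; split => //.
move=> /(_ gE) /le_lt_trans; apply; rewrite /d mulfK ?gt_eqF // /c.
by lra.
Qed.

End Barrier.

(** * Complex coordinates and the action of the polydisc *)

Section ComplexTopology.
Local Open Scope complex_scope.
Context {R : realType}.
Local Notation C := (R[i])^o.

Lemma normC_le (a b r : R) : 0 <= r ->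
  (`|(a +i* b : R[i])| <= r%:C) = (a ^+ 2 + b ^+ 2 <= r ^+ 2).
Proof.
move=> r0; rewrite normc_def lecR /= -[RHS]ler_sqrt ?exprn_even_ge0 //.
  by rewrite [Num.sqrt (r ^+ 2)]sqrtr_sqr ger0_norm.
Qed.

Lemma normC_le1 (a b : R) : (`|(a +i* b : R[i])| <= 1) = (a ^+ 2 + b ^+ 2 <= 1).
Proof. by have := @normC_le a b 1 ler01; rewrite expr1n. Qed.

Lemma norm_expi (t : R) : `|expi t| = 1 :> R[i].
Proof. by rewrite normc_def /= cos2Dsin2 sqrtr1. Qed.

(** A positive element of [R[i]] is real, so the complex balls of the topology have
real radii. *)
Lemma cvg_complex (T : Type) (F : set_system T) (FF : Filter F) (a b : T -> R) (a0 b0 : R) :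
  a z @[z --> F] --> a0 -> b z @[z --> F] --> b0 ->
  (a z +i* b z : C) @[z --> F] --> (a0 +i* b0 : C).
Proof.
move=> /cvgrPdist_lt ca /cvgrPdist_lt cb; apply/cvgrPdist_le => e e0.
have [e' e'E] : exists e' : R, e = e'%:C.
  by apply/complex_realP; exact: gtr0_real.
rewrite e'E in e0 *; have {}e0 : 0 < e' by rewrite -ltcR.
have e2 : 0 < e' / 2 by rewrite divr_gt0.
move: (ca _ e2) (cb _ e2); apply: filterS2 => z az bz.
have -> : (a0 +i* b0 : C) - (a z +i* b z) = ((a0 - a z) +i* (b0 - b z)) by [].
rewrite normC_le ?(ltW e0) //.
move: az bz; rewrite -[(a0 - a z) ^+ 2]real_normK ?num_real //
  -[(b0 - b z) ^+ 2]real_normK ?num_real //.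
have := normr_ge0 (a0 - a z); have := normr_ge0 (b0 - b z).
by move: (`|a0 - a z|) (`|b0 - b z|) => u v; nra.
Qed.

Lemma cvg_row (T : Type) (F : set_system T) (FF : Filter F) n
    (f : T -> 'rV[C]_n) (l : 'rV[C]_n) :
  (forall j, f z ord0 j @[z --> F] --> l ord0 j) -> f z @[z --> F] --> l.
Proof.
move=> h; apply/cvg_ballP => e e0.
have : forall j, \forall z \near F, ball (l ord0 j) e (f z ord0 j).
  by move=> j; have /cvg_ballP := h j; apply.
move=> /filter_forall; apply: filterS => z hz.
by split => // i j; rewrite ord1; exact: hz.
Qed.

Lemma cvg_coord n (z : 'rV[C]_n) j : (z' : 'rV[C]_n) ord0 j @[z' --> z] --> z ord0 j.
Proof. exact: (@coord_continuous R[i] 1 n ord0 j z). Qed.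

Definition cdisc : set C := [set l | `|l| <= 1].

Lemma cdiscE : cdisc = (fun p : R * R => (p.1 +i* p.2 : C)) @` disc.
Proof.
apply/seteqP; split => [[a b]|_ [[a b] ab <-]]; rewrite /cdisc /= normC_le1 //.
by move=> ab; exists (a, b).
Qed.

Lemma cvg_pairC (p : R * R) : (p'.1 +i* p'.2 : C) @[p' --> p] --> (p.1 +i* p.2 : C).
Proof. by apply: cvg_complex; [exact: cvg_fst|exact: cvg_snd]. Qed.

Lemma compact_cdisc : compact cdisc.
Proof.
rewrite cdiscE; apply: continuous_compact; last exact: compact_disc.
by apply: continuous_subspaceT => p; exact: cvg_pairC.
Qed.

Definition polydisc n : set 'rV[C]_n := [set w | forall j, cdisc (w ord0 j)].

Lemma compact_polydisc n : compact (@polydisc n).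
Proof. by apply: (@rV_compact C n (fun=> cdisc)) => i; exact: compact_cdisc. Qed.

(** The coordinatewise product: [polydisc] and [torus] act on C^n through it. *)
Definition had n (w z : 'rV[C]_n) : 'rV[C]_n := \row_j (w ord0 j * z ord0 j).

Definition torus n (th : 'I_n -> R) : 'rV[C]_n := \row_j (expi (th j) : C).

Lemma cvg_had (T : Type) (F : set_system T) (FF : Filter F) n
    (f g : T -> 'rV[C]_n) (l m : 'rV[C]_n) :
  f z @[z --> F] --> l -> g z @[z --> F] --> m -> had (f z) (g z) @[z --> F] --> had l m.
Proof.
move=> fl gm; apply: cvg_row => j.
rewrite /had mxE; under eq_fun do rewrite mxE.
have fj : f z ord0 j @[z --> F] --> l ord0 j := cvg_comp _ _ fl (@cvg_coord n l j).
have gj : g z ord0 j @[z --> F] --> m ord0 j := cvg_comp _ _ gm (@cvg_coord n m j).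
exact: (cvgM fj gj).
Qed.

End ComplexTopology.

(** * Complete Reinhardt domains and limits on tori *)

Section Lines.
Local Open Scope complex_scope.
Context {R : realType} {n : nat}.
Local Notation C := (R[i])^o.
Local Notation Cn := 'rV[C]_n.
Implicit Types (D : set Cn) (f : Cn -> R) (p q z w : Cn).

Lemma cvg_affine (T : Type) (F : set_system T) (FF : Filter F) (a : T -> C) (a0 : C) p q :
  a x @[x --> F] --> a0 -> (p + a x *: q : Cn) @[x --> F] --> (p + a0 *: q : Cn).
Proof.
by move=> aa; apply: cvgD; [exact: cvg_cst|apply: cvgZ => //; exact: cvg_cst].
Qed.

Definition cline p q (x : R * R) : Cn := p + (x.1 +i* x.2 : R[i]) *: q.

Lemma cvg_cline p q x : cline p q x' @[x' --> x] --> cline p q x.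
Proof. by apply: cvg_affine; exact: cvg_pairC. Qed.

(** The bridge from plurisubharmonic functions to the one-variable theory. *)
Lemma psh_line D f p q : psh D (EFin \o f) ->
  (forall x, disc x -> D (cline p q x)) ->
  usc_disc (f \o cline p q) /\ submean (f \o cline p q).
Proof.
move=> [_ uf sf] Dl; split.
  move=> x a dx fa.
  have /(_ fa) := uf _ a (Dl _ dx).
  move=> /(@cvg_cline p q x); rewrite nbhs_simpl /=.
  by apply: filterS => x' /= h /Dl /h.
move=> x y s cin /=.
have := sf (cline p q (x, y)) (s%:C *: q).
have E (a b : R) : cline p q (x, y) + (a +i* b : R[i]) *: (s%:C *: q) =
    cline p q (x + s * a, y + s * b).
  rewrite /cline -addrA scalerA -scalerDl; congr (_ + _ *: _).
  by apply/eqP; rewrite eq_complex /=; apply/andP; split; apply/eqP; ring.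
have -> : (fun t : R => (EFin \o f) (cline p q (x, y) + expi t *: (s%:C *: q))) =
    (fun t : R => (f (cline p q (circle x y s t)))%:E).
  by apply/funext => t; rewrite /= /expi E.
apply => -[a b]; rewrite normC_le1 => ab; rewrite E.
by apply: Dl; exact: circle_in_disc.
Qed.

Definition scale_coord (j : 'I_n) (l : R[i]) z : Cn :=
  \row_k (if k == j then l * z ord0 k else z ord0 k).

(** Shrink by [s] the disc obtained by multiplying the [j]-th coordinate of [z] by
[l], [|l| <= 1].  Its boundary is a rotation of [s z], so it stays in a compact part
of [D] as [s] runs through [[0, 1]].  As long as the disc lies in [D], the maximum
principle for the exhaustion function keeps it in a fixed compact subset [L] of
[D]; hence the supremum of the admissible [s] is admissible and, [D] being open,
cannot be less than [1]. *)
Lemma complete_coord D j l z : complete_pseudoconvex_Reinhardt D -> D z ->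
  `|l| <= 1 -> D (scale_coord j l z).
Proof.
move=> [[_ oD _] [phi [pphi _ exh]] mD bD] Dz l1.
have [_ uphi _] := pphi.
pose p : Cn := \row_k (if k == j then 0 else z ord0 k).
pose q : Cn := \row_k (if k == j then z ord0 k else 0).
have pqE m : p + m *: q = scale_coord j m z.
  apply/rowP => k; rewrite !mxE; case: ifP => _; first by rewrite add0r.
  by rewrite mulr0 addr0.
have circD (t : R) : D (p + expi t *: q).
  rewrite pqE.
  have := mD (fun k => if k == j then t else 0) _ Dz; congr D.
  apply/rowP => k; rewrite !mxE; case: ifP => _ //.
  by rewrite /expi cos0 sin0 mul1r.
have circsD (s t : R) : 0 <= s <= 1 -> D (s%:C *: (p + expi t *: q)).
  move=> /andP[s0 s1]; apply: bD => //.
  by rewrite normC_le1 /= expr0n /= addr0 expr_le1.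
pose ps (st : R * R) : Cn := st.1%:C *: (p + expi st.2 *: q).
have cps st : ps st' @[st' --> st] --> ps st.
  apply: cvgZ; first by apply: cvg_complex; [exact: cvg_fst|exact: cvg_cst].
  apply: cvgD; first exact: cvg_cst.
  apply: cvgZ; last exact: cvg_cst.
  by apply: cvg_complex; apply: cvg_comp (@cvg_snd _ _ _ _ _) _;
    [exact: continuous_cos|exact: continuous_sin].
have p20 : 0 <= 2 * pi :> R by rewrite mulr_ge0 // pi_ge0.
(* An upper bound of phi on the boundaries of all the shrunken discs. *)
have [|||st0 _ maxst] := @usc_compact_max R (R * R)%type
    (`[0, 1]%classic `*` `[0, 2 * pi]%classic)
    (phi \o ps).
- by apply: compact_setX; exact: segment_compact.
- by exists (0, 0); split => /=; rewrite in_itv /= ?lexx ?ler01.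
- move=> [s t] a [/= s01 _] fa.
  have st01 : D (ps (s, t)) by apply: circsD; move: s01; rewrite in_itv.
  have h0 : nbhs (s, t) (fun y => D (ps y) -> ((EFin \o phi) (ps y) < a%:E)%E).
    exact: (cps (s, t) _ (uphi _ a st01 fa)).
  apply: filterS h0 => -[s' t'] /= h [/=]; rewrite in_itv /= => s01' _.
  exact: (h (circsD s' t' s01')).
set M := phi (ps st0) in maxst.
have [L [cL LD phiL]] := exh (M + 1).
have clL : closed L by apply: compact_closed => //; exact: norm_hausdorff.
pose A := [set s : R | 0 <= s <= 1 /\ forall m : R[i], `|m| <= 1 -> D (s%:C *: (p + m *: q))].
have A0 : A 0.
  split; first by rewrite lexx ler01.
  move=> m _; rewrite scale0r; have := bD _ 0 Dz; rewrite scale0r normr0; apply.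
  exact: ler01.
have A_sub s : A s -> forall m : R[i], `|m| <= 1 -> L (s%:C *: (p + m *: q)).
  move=> [s01 sD] [a b] ab; apply: phiL.
  split; first exact: sD.
  have clE x : cline (s%:C *: p) (s%:C *: q) x = s%:C *: (p + (x.1 +i* x.2 : R[i]) *: q).
    by rewrite /cline scalerDr !scalerA mulrC.
  have [||ug sg] := @psh_line D phi (s%:C *: p) (s%:C *: q).
  - exact: pphi.
  - by move=> [x y] xy; rewrite clE; apply: sD; rewrite normC_le1.
  have := @disc_max_principle R _ (fun=> M) ug sg _ _ _ (a, b).
  rewrite /= clE /= => h; apply: le_lt_trans (h _ _ _ _) _.
  - by move=> *; exact: cvg_cst.
  - by move=> *; exact: has_mean_cst.
  - move=> t; rewrite clE /=.
    have [t' t'02 [ct st]] := unit_circle_polar (cos2Dsin2 t).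
    have := maxst (s, t'); rewrite /ps /= /expi -ct -st; apply.
    by split; rewrite /= in_itv.
  - by move: ab; rewrite normC_le1.
  - by rewrite ltrDl.
have sA : has_sup A by split; [exists 0|exists 1 => s [/andP[]]].
pose s1 := sup A.
have s101 : 0 <= s1 <= 1.
  apply/andP; split; first exact: (sup_upper_bound sA).
  by apply: ge_sup; [exists 0|move=> s [/andP[]]].
have As1 : A s1.
  split => // m m1; apply: LD; apply: clL => U.
  have cs : ((s%:C : C) *: (p + (m : C) *: q) : Cn) @[s --> s1] -->
      ((s1%:C : C) *: (p + (m : C) *: q) : Cn).
    by apply: cvgZ; [apply: cvg_complex; [exact: cvg_id|exact: cvg_cst]|exact: cvg_cst].
  move=> /cs; rewrite nbhs_simpl /= => /nbhs_ballP [e /= e0 he].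
  have [s As es] := sup_adherent e0 sA.
  exists (s%:C *: (p + m *: q)); split; first exact: A_sub.
  apply: he; rewrite /ball /= ger0_norm ?subr_ge0.
    by rewrite ltrBlDr -ltrBlDl.
  exact: (sup_upper_bound sA).
suff -> : scale_coord j l z = 1%:C *: (p + l *: q).
  suff <- : s1 = 1 by case: As1 => _; exact.
  apply/eqP; rewrite eq_le (andP s101).2 /= leNgt; apply/negP => s1lt.
  have /compact_near_coveringP cov := @compact_cdisc R.
  have near1 : \forall s \near s1, cdisc `<=` (fun m => D (s%:C *: (p + m *: q))).
    apply: (cov R (nbhs s1) (fun s m => D (s%:C *: (p + m *: q))) _) => m m1.
    have cm : ((ms.2%:C : C) *: (p + (ms.1 : C) *: q) : Cn) @[ms --> (nbhs m, nbhs s1)] -->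
        ((s1%:C : C) *: (p + (m : C) *: q) : Cn).
      apply: cvgZ; first by apply: cvg_complex; [exact: cvg_snd|exact: cvg_cst].
      apply: cvgD; first exact: cvg_cst.
      by apply: cvgZ; [exact: cvg_fst|exact: cvg_cst].
    apply: (cm D); move: oD; rewrite openE; apply; exact: As1.2.
  have := @filter_ex _ (at_right s1) _ _ (filterI (nbhs_right_le s1lt)
    (filterI (nbhs_right_gt s1) (cvg_at_right_filter (@cvg_id _ (nbhs s1)) near1))).
  move=> [s [s_le1 [s_gt sD]]].
  have : s <= s1.
    apply: (sup_upper_bound sA); split; last exact: sD.
    by rewrite s_le1 (le_trans (andP s101).1 (ltW s_gt)).
  by rewrite leNgt s_gt.
by rewrite scale1r pqE.
Qed.

(** The coordinates are multiplied one after the other. *)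
Lemma complete_had D w z : complete_pseudoconvex_Reinhardt D -> D z ->
  polydisc w -> D (had w z).
Proof.
move=> cD Dz pw.
suff H k : (k <= n)%N -> D (\row_j ((if (j < k)%N then w ord0 j else 1) * z ord0 j)).
  have := H n (leqnn n); congr D; apply/rowP => j; rewrite !mxE.
  by rewrite ltn_ord.
elim: k => [_|k IH kn].
  by move: Dz; congr D; apply/rowP => j; rewrite !mxE mul1r.
have := complete_coord (Ordinal kn) cD (IH (ltnW kn)) (pw (Ordinal kn)); congr D.
apply/rowP => j; rewrite !mxE [(j < k.+1)%N]ltnS -val_eqE /=.
by case: ltngtP => // jk; rewrite mul1r; congr (w _ _ * _); exact: val_inj.
Qed.

(** Induction on the number [k] of coordinates that have moved from the circle into
the disc of radius [r]; [two_constants] moves the next one.  Its uniformity allows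
the moved coordinates to depend on [m]. *)
Lemma torus_to_polydisc D f (zs : nat -> Cn) (r : R) :
  complete_pseudoconvex_Reinhardt D -> psh D (EFin \o f) ->
  (forall z, D z -> f z <= 0) -> (forall m, D (zs m)) -> 0 <= r < 1 ->
  (forall (th : 'I_n -> R) e, 0 < e ->
    \forall m \near \oo, f (had (torus th) (zs m)) < -1 + e) ->
  forall (ws : nat -> Cn), (forall m j, `|ws m ord0 j : R[i]| <= r%:C) ->
  forall e, 0 < e -> \forall m \near \oo, f (had (ws m) (zs m)) < -1 + e.
Proof.
move=> cD pf f0 Dzs r01 torus ws wsr.
have r_le1 : r%:C <= 1 by rewrite (lecR r 1) ltW // (andP r01).2.
suff H k : (k <= n)%N -> forall (ws : nat -> Cn),
    (forall m (j : 'I_n), (j < k)%N -> `|ws m ord0 j : R[i]| <= r%:C) ->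
    (forall j : 'I_n, (k <= j)%N -> exists t : R, forall m, ws m ord0 j = expi t) ->
    forall e, 0 < e -> \forall m \near \oo, f (had (ws m) (zs m)) < -1 + e.
  apply: (H n (leqnn n)) => // j; rewrite leqNgt ltn_ord //.
elim: k => [_ {wsr}|k IH kn {wsr}] {}ws wsr wst e e0.
  have /choice [th thE] : forall j : 'I_n, exists t : R, forall m, ws m ord0 j = expi t.
    by move=> j; exact: wst.
  have := torus th e e0; apply: filterS => m; congr (f (had _ _) < _).
  by apply/rowP => j; rewrite mxE thE.
pose j0 : 'I_n := Ordinal kn.
pose p m : Cn := \row_j (if j == j0 then 0 else ws m ord0 j * zs m ord0 j).
pose q m : Cn := \row_j (if j == j0 then zs m ord0 j else 0).
pose upd m (x : R * R) : Cn := \row_j (if j == j0 then (x.1 +i* x.2 : R[i]) else ws m ord0 j).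
have lineE m x : cline (p m) (q m) x = had (upd m x) (zs m).
  apply/rowP => j; rewrite !mxE; case: ifP => _; first by rewrite add0r.
  by rewrite mulr0 addr0.
have updP m x : disc x -> polydisc (upd m x).
  move=> dx j; rewrite /cdisc /= mxE; case: ifP => [_|/eqP jj0].
    by rewrite normC_le1.
  have [kj|jk] := ltnP k j; last first.
    apply: le_trans r_le1; apply: wsr; rewrite ltnS //.
  by have [t ->] := wst j kj; rewrite norm_expi.
have Dl m x : disc x -> D (cline (p m) (q m) x).
  by move=> dx; rewrite lineE; apply: complete_had => //; exact: updP.
have : forall (t : R) e, 0 < e -> \forall m \near \oo,
    (f \o cline (p m) (q m)) (cos t, sin t) < -1 + e.
  move=> t {}e {}e0.
  have := IH (ltnW kn) (fun m => upd m (cos t, sin t)) _ _ e e0.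
  have h1 m (j : 'I_n) : (j < k)%N -> `|upd m (cos t, sin t) ord0 j : R[i]| <= r%:C.
    move=> jk; rewrite mxE -val_eqE /= ltn_eqF //; apply: wsr; exact: ltnW.
  have h2 (j : 'I_n) : (k <= j)%N -> exists t' : R, forall m,
      upd m (cos t, sin t) ord0 j = expi t'.
    move=> kj; have [jj0|jj0] := eqVneq j j0.
      by exists t => m; rewrite mxE jj0 eqxx.
    have [|t' t'E] := wst j.
      by rewrite ltn_neqAle kj andbT eq_sym.
    by exists t' => m; rewrite mxE (negbTE jj0).
  by move=> /(_ h1 h2); apply: filterS => m; rewrite /= lineE.
move=> lim.
have := two_constants (fun m => (psh_line pf (Dl m)).1)
  (fun m => (psh_line pf (Dl m)).2) (fun m x dx => f0 _ (Dl m x dx)) lim r01 e0.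
apply: filterS => m.
move=> /(_ (complex.Re (ws m ord0 j0), complex.Im (ws m ord0 j0))) /=.
rewrite lineE.
have -> : upd m (complex.Re (ws m ord0 j0), complex.Im (ws m ord0 j0)) = ws m.
  apply/rowP => j; rewrite mxE; case: eqP => // -> /=.
  by case: (ws m ord0 j0).
apply; have := wsr m j0 (ltnSn k); case: (ws m ord0 j0) => a b /=.
by rewrite normC_le // (andP r01).1.
Qed.

(** For a vanishing coordinate of [z] there is nothing to prove, which is why the
estimate is multiplicative and survives at the coordinate hyperplanes. *)
Lemma near_coord_ge z (l : R[i]) : `|l| < 1 ->
  \forall z' \near z, forall j : 'I_n,
    `|l| * `|(z : Cn) ord0 j : R[i]| <= `|(z' : Cn) ord0 j : R[i]|.
Proof.
move=> l1; apply: (@filter_forall Cn 'I_n _ (nbhs z) (nbhs_filter (z : Cn))) => j.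
have [zj0|zj0] := eqVneq (z ord0 j) 0.
  by near=> z'; rewrite zj0 normr0 mulr0.
have d0 : 0 < (1 - `|l|) * `|z ord0 j : R[i]|.
  by rewrite mulr_gt0 ?subr_gt0 // normr_gt0.
have cj := @cvg_coord R n z j.
move/cvgrPdist_lt: cj => /(_ _ d0); apply: filterS => z' h.
have := lerB_dist (z ord0 j : R[i]) (z ord0 j - z' ord0 j).
rewrite subKr => /(le_trans _); apply.
rewrite lerBrDr -lerBrDl; apply: le_trans (ltW h) _.
by rewrite mulrBl mul1r.
Unshelve. all: by end_near. Qed.

(** The quotient is taken coordinatewise; where the denominator vanishes so does the
numerator, and division by [0] gives the harmless value [0]. *)
Lemma coord_le_had z z' : (forall j, `|z ord0 j : R[i]| <= `|z' ord0 j : R[i]|) ->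
  exists2 w, polydisc w & had w z' = z.
Proof.
move=> h; exists (\row_j (z ord0 j / z' ord0 j)) => [j|].
  rewrite /cdisc /= mxE.
  have [->|z'j0] := eqVneq (z' ord0 j) 0; first by rewrite invr0 mulr0 normr0 ler01.
  by rewrite normrM normfV ler_pdivrMr ?normr_gt0 // mul1r.
apply/rowP => j; rewrite !mxE.
have [z'j0|z'j0] := eqVneq (z' ord0 j) 0; last by rewrite divfK.
by have := h j; rewrite z'j0 mulr0 normr0 normr_le0 => /eqP.
Qed.

Lemma near_shift (P : nat -> Prop) N :
  (\forall m \near \oo, P m) -> \forall m \near \oo, P (N + m)%N.
Proof.
move=> [N0 _ h]; exists N0 => // m /= Nm; apply: h => /=.
exact: leq_trans Nm (leq_addl _ _).
Qed.

(** The point [had w z0] is fixed, but it can be written [had (ws m) (zs m)] with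
factors that stay in a polydisc of radius [s < 1], because the coordinates of
[zs m] converge to nonzero limits. *)
Lemma boundary_to_polydisc D f (zs : nat -> Cn) (z0 w : Cn) (r : R) :
  complete_pseudoconvex_Reinhardt D -> psh D (EFin \o f) ->
  (forall z, D z -> f z <= 0) -> (forall m, D (zs m)) ->
  zs m @[m --> \oo] --> z0 -> (forall j, z0 ord0 j <> 0) ->
  (forall (th : 'I_n -> R) e, 0 < e ->
    \forall m \near \oo, f (had (torus th) (zs m)) < -1 + e) ->
  0 <= r < 1 -> (forall j, `|w ord0 j : R[i]| <= r%:C) ->
  f (had w z0) <= -1.
Proof.
move=> cD pf f0 Dzs zsz0 z0n torus r01 wr.
have /andP[r0 r1] := r01.
(* r <= s * s < 1 leaves a factor s for the error in the denominators. *)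
pose s := (1 + r) / 2.
have s0 : 0 < s by rewrite divr_gt0 // ltr_pwDl.
have s1 : s < 1 by rewrite /s; lra.
have rs : r <= s * s by rewrite /s; nra.
have sC0 : 0 < s%:C by rewrite (ltcR 0 s).
have sn : `|s%:C : R[i]| = s%:C by rewrite ger0_norm // ltW.
have s1C : `|s%:C : R[i]| < 1 by rewrite sn (ltcR s 1).
have : \forall m \near \oo, forall j : 'I_n,
    `|s%:C : R[i]| * `|z0 ord0 j : R[i]| <= `|zs m ord0 j : R[i]|.
  exact: (zsz0 _ (near_coord_ge z0 s1C)).
rewrite sn.
move=> [N _ hN].
have zsn m j : zs (N + m)%N ord0 j != 0.
  rewrite -normr_gt0; apply: lt_le_trans (hN (N + m)%N (leq_addr _ _) j).
  by apply: mulr_gt0 => //; rewrite normr_gt0; exact/eqP/z0n.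
pose ws m : Cn := \row_j (w ord0 j * z0 ord0 j / zs (N + m)%N ord0 j).
have wsE m : had (ws m) (zs (N + m)%N) = had w z0.
  by apply/rowP => j; rewrite !mxE divfK.
have wss m j : `|ws m ord0 j : R[i]| <= s%:C.
  rewrite mxE normrM normrM normfV ler_pdivrMr ?normr_gt0 //.
  apply: le_trans (_ : s%:C * (s%:C * `|z0 ord0 j : R[i]|) <= _); last first.
    by rewrite ler_pM2l //; exact: hN (leq_addr _ _) j.
  rewrite mulrA ler_wpM2r //; apply: le_trans (wr j) _.
  by rewrite -rmorphM lecR.
have s01 : 0 <= s < 1 by rewrite ltW.
have := torus_to_polydisc cD pf f0 (fun m => Dzs (N + m)%N) s01
  (fun th e e0 => near_shift N (torus th e e0)) wss.
move=> H; apply/ler_addgt0Pr => e e0.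
have [M _ hM] := H _ e0.
by have := hM M (leqnn M); rewrite wsE => /ltW.
Qed.

End Lines.

(** * Maximal functions over the polydisc *)

Section Hull.
Local Open Scope complex_scope.
Context {R : realType} {n : nat}.
Local Notation C := (R[i])^o.
Local Notation Cn := 'rV[C]_n.
Implicit Types (D : set Cn) (f : Cn -> R) (p q z w : Cn).

(** Otherwise [f <= a] at all points [l p], [|l| < 1].  A small circle about [p] in the
complex line of [p] has a definite part among these points, and on the rest of it
upper semicontinuity keeps [f] close to [f p]; so the mean over the circle is
smaller than [f p]. *)
Lemma psh_radial D f p (a : R) : open D -> psh D (EFin \o f) -> D p -> a < f p ->
  exists2 l : R[i], `|l| < 1 & a < f (l *: p).
Proof.
move=> oD [_ uf sf] Dp afp; apply: contrapT => no.
have fa (l : R[i]) : `|l| < 1 -> f (l *: p) <= a.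
  by move=> l1; rewrite leNgt; apply/negP => al; apply: no; exists l.
pose k := f p - a; have k0 : 0 < k by rewrite subr_gt0.
have fk : f p < f p + k / 16 by rewrite ltrDl divr_gt0.
have near0 : nbhs (0 : C) (fun l =>
    D (p + (l : R[i]) *: p) /\ f (p + (l : R[i]) *: p) < f p + k / 16).
  have c0 : (p + l *: p : Cn) @[l --> (0 : C)] --> (p : Cn).
    have := @cvg_affine R n C (nbhs (0 : C)) (nbhs_filter (0 : C)) id 0 p p (@cvg_id _ _).
    by rewrite scale0r addr0.
  have oDp : nbhs p D by move: oD; rewrite openE; apply.
  have h1 : nbhs (0 : C) (fun l => D (p + (l : R[i]) *: p)) := c0 _ oDp.
  have h2 : nbhs (0 : C) (fun l => D (p + (l : R[i]) *: p) ->
      ((EFin \o f) (p + (l : R[i]) *: p)%R < (f p + k / 16)%:E)%E) := c0 _ (uf _ _ Dp fk).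
  by move: h1 h2; apply: filterS2 => l Dl /(_ Dl).
move/nbhs_ballP : near0 => [e /= e0 he].
have [e' e'E] : exists e' : R, e = e'%:C by apply/complex_realP; exact: gtr0_real.
rewrite e'E in e0 he; have {}e0 : 0 < e' by rewrite -(ltcR 0 e').
pose rho := Num.min (e' / 2) (1 / 8).
have rho0 : 0 < rho by rewrite lt_min !divr_gt0.
have rho8 : rho <= 1 / 8 by rewrite ge_min lexx orbT.
have rhoe : rho < e'.
  by apply: (@le_lt_trans _ _ (e' / 2));
    [rewrite ge_min lexx|rewrite ltr_pdivrMr // ltr_pMr // ltr1n].
have small (l : R[i]) : `|l| <= 1 ->
    D (p + l *: (rho%:C *: p)) /\ f (p + l *: (rho%:C *: p)) < f p + k / 16.
  move=> l1; rewrite scalerA; apply: he.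
  rewrite /ball /= sub0r normrN normrM.
  apply: (@le_lt_trans _ _ (1 * rho%:C)); last by rewrite mul1r ltcR.
  rewrite (_ : `|rho%:C| = rho%:C); last by apply: ger0_norm; rewrite (lecR 0) ltW.
  by rewrite ler_wpM2r // (lecR 0) ltW.
(* On the circle p (1 + rho e^(it)) the points with 2 cos t < - rho are the inner
   ones.  The polynomial (c - c ^+ 2) / 2 in c = cos t is at least -1, so that Q
   stays above a = f p - k at the inner points; it is almost nonnegative at the
   others, and k times its mean -1/4 outweighs k / 8. *)
pose Q (t : R) := f p + k / 8 + k * (2^-1 * cos t + - 2^-1 * cos t ^+ 2).
have cQ : continuous Q.
  move=> t; apply: cvgD; first exact: cvg_cst.
  apply: cvgM; first exact: cvg_cst.
  apply: cvgD; apply: cvgM; [exact: cvg_cst|exact: continuous_cos|exact: cvg_cst|].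
  by apply: cvg_sqr; exact: continuous_cos.
have mQ : has_mean Q (f p + k / 8 + k * (2^-1 * 0 + - 2^-1 * 2^-1)).
  apply: has_meanD; first exact: has_mean_cst.
  apply: has_meanZ; apply: has_meanD; first exact/has_meanZ/has_mean_cos.
  exact/has_meanZ/has_mean_cos2.
have fQ t : f (p + expi t *: (rho%:C *: p)) <= Q t.
  have := small (expi t); rewrite norm_expi lexx => /(_ isT) [_ fs].
  have c1 := cos_le1 t; have c2 := cos_geN1 t.
  have cs := cos2Dsin2 t.
  have [ct|ct] := ltP (2 * cos t) (- rho).
    have : f (p + expi t *: (rho%:C *: p)) <= a.
      have -> : p + expi t *: (rho%:C *: p) =
          ((1 + rho * cos t) +i* (rho * sin t) : R[i]) *: p.
        rewrite scalerA -{1}[p]scale1r -scalerDl; congr (_ *: _).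
        by apply/eqP; rewrite eq_complex /=; apply/andP; split; apply/eqP; ring.
      apply: fa; rewrite lt_neqAle normC_le1; apply/andP; split; last by nra.
      apply/eqP => /(congr1 (fun z : R[i] => z ^+ 2)); rewrite -add_Re2_Im2 /= expr1n.
      by move=> /(congr1 (@complex.Re R)) /=; nra.
    rewrite /Q /k; move: (cos t) c1 c2 ct => c c1 c2 ct h.
    have : -1 <= 2^-1 * c + - 2^-1 * c ^+ 2 by nra.
    move: (2^-1 * c + _) => y y1; move: k0; rewrite /k; nra.
  apply: le_trans (ltW fs) _; rewrite /Q.
  have : - (1 / 16) <= 2^-1 * cos t + - 2^-1 * cos t ^+ 2 by nra.
  by move: (2^-1 * cos t + _) => y y1; nra.
have := sf p (rho%:C *: p) (fun l l1 => (small l l1).1).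
apply/negP; rewrite -ltNge.
have p20 : 0 < 2 * pi :> R by rewrite mulr_gt0 // pi_gt0.
apply: (@le_lt_trans _ _ ((2 * pi)^-1%:E *
    \int[lebesgue_measure]_(t in `[0%R, (2 * pi)%R]) (Q t)%:E)%E).
  rewrite lee_pmul2l // ?lte_fin ?invr_gt0 //.
  by apply: integral_mono => t _; rewrite lee_fin.
rewrite (integral_has_mean cQ mQ) -EFinM lte_fin mulrA mulVf ?gt_eqF // mul1r.
by move: k0; lra.
Qed.

Definition polydisc_max f z := sup [set f (had w z) | w in @polydisc R n].

Definition ones : Cn := \row_j 1.

Lemma ones_polydisc : polydisc ones.
Proof. by move=> j; rewrite /cdisc /= mxE normr1. Qed.

Lemma had1 z : had ones z = z.
Proof. by apply/rowP => j; rewrite !mxE mul1r. Qed.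

(** A point [z'] of [D] close to [z] dominates [r z] coordinatewise. *)
Lemma closure_dilate D z (r : R) : complete_pseudoconvex_Reinhardt D -> 0 <= r < 1 ->
  closure D z -> D (r%:C *: z).
Proof.
move=> cD /andP[r0 r1] clz.
have rn : `|r%:C : R[i]| < 1 by rewrite ger0_norm ?(lecR 0 r) // (ltcR r 1).
have [z' [Dz' h]] := clz _ (near_coord_ge z rn).
have [|v pv <-] := @coord_le_had R n (r%:C *: z) z'; last exact: complete_had.
by move=> j; rewrite mxE normrM.
Qed.

Section Fixed.
Variables (D : set Cn) (f : Cn -> R).
Hypothesis cD : complete_pseudoconvex_Reinhardt D.
Hypothesis pf : psh D (EFin \o f).

Let oD : open D. Proof. by case: cD => [[]]. Qed.

(** Joint upper semicontinuity, in the form required by the compactness of the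
polydisc. *)
Let usc_had z w a : D z -> polydisc w -> f (had w z) < a ->
  \forall w' \near w & z' \near z, D (had w' z') -> f (had w' z') < a.
Proof.
move=> Dz pw fa; case: pf => _ uf _.
have chad : had wz.1 wz.2 @[wz --> (nbhs w, nbhs z)] --> had w z.
  by apply: cvg_had; [exact: cvg_fst|exact: cvg_snd].
exact: (chad _ (uf _ _ (complete_had cD Dz pw) fa)).
Qed.

Lemma polydisc_maxP z : D z -> exists2 w, polydisc w & polydisc_max f z = f (had w z) /\
  forall v, polydisc v -> f (had v z) <= polydisc_max f z.
Proof.
move=> Dz.
have [||| w pw maxw] := @usc_compact_max R _ (@polydisc R n) (fun w => f (had w z)).
- exact: compact_polydisc.
- by exists ones; exact: ones_polydisc.
- move=> w a pw fa; case: pf => _ uf _.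
  have chad : had w' z @[w' --> w] --> had w z 
    by apply: (@cvg_had R Cn (nbhs w) (nbhs_filter (w : Cn)) n id (fun=> z));
      [exact: cvg_id|exact: cvg_cst].
  have h : nbhs w (fun w' => D (had w' z) -> ((EFin \o f) (had w' z) < a%:E)%E) :=
    chad _ (uf _ _ (complete_had cD Dz pw) fa).
  apply: filterS h => w' h pw'; exact: (h (complete_had cD Dz pw')).
have ub v : polydisc v -> f (had v z) <= polydisc_max f z.
  move=> pv; apply: ub_le_sup; last by exists v.
  by exists (f (had w z)) => _ [v' pv' <-]; exact: maxw.
exists w => //; split => //; apply/eqP; rewrite eq_le ub // andbT.
apply: ge_sup; first by exists (f (had w z)); exists w.
by move=> _ [v pv <-]; exact: maxw.
Qed.

Lemma le_polydisc_max z : D z -> f z <= polydisc_max f z.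
Proof.
move=> Dz; have [w pw [_ /(_ _ ones_polydisc)]] := polydisc_maxP Dz.
by rewrite had1.
Qed.

Lemma polydisc_max_usc z a : D z -> polydisc_max f z < a ->
  \forall z' \near z, D z' -> polydisc_max f z' < a.
Proof.
move=> Dz Fa.
have [w0 pw0 [Fw0 maxw0]] := polydisc_maxP Dz.
have /compact_near_coveringP/near_covering_withinP cov := @compact_polydisc R n.
have H : \forall z' \near z, @polydisc R n `<=` (fun w => D (had w z') -> f (had w z') < a).
  apply: (cov Cn (nbhs z) (fun z' w => D (had w z') -> f (had w z') < a) _) => w pw.
  have := usc_had Dz pw (le_lt_trans (maxw0 _ pw) Fa).
  by apply: filterS => -[w' z'].
apply: filterS H => z' H Dz'.
have [w pw [-> _]] := polydisc_maxP Dz'.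
by apply: H => //; exact: complete_had.
Qed.

(** Let the maximum at [z] be taken at [had w0 z].  By [psh_radial] a point
[l (had w0 z)] with [|l| < 1] still gives a value larger than [a], and near [z] every
[z'] dominates it coordinatewise. *)
Lemma polydisc_max_lsc z a : D z -> a < polydisc_max f z ->
  \forall z' \near z, D z' -> a < polydisc_max f z'.
Proof.
move=> Dz; have [w0 pw0 [-> _]] := polydisc_maxP Dz => aF.
have [l l1 al] := psh_radial oD pf (complete_had cD Dz pw0) aF.
have H := near_coord_ge z l1.
apply: filterS H => z' H Dz'.
have [w pw [_ maxw]] := polydisc_maxP Dz'.
have [|v pv vE] := @coord_le_had R n (l *: had w0 z) z'.
  move=> j; apply: le_trans (H j); rewrite !mxE !normrM; apply: ler_wpM2l => //.
  by apply: ler_piMl => //; exact: pw0.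
by apply: (lt_le_trans al); rewrite -vE; exact: maxw.
Qed.

Lemma polydisc_max_continuous z : D z -> {for z, continuous (polydisc_max f)}.
Proof.
move=> Dz; apply/(@cvgrPdist_lt _ _ _ (nbhs z) (nbhs_filter (z : Cn))) => e e0.
have Dn : nbhs z D by move: oD; rewrite openE; apply.
have h1 : polydisc_max f z < polydisc_max f z + e by rewrite ltrDl.
have h2 : polydisc_max f z - e < polydisc_max f z by rewrite ltrBlDr ltrDl.
have Fz := nbhs_filter (z : Cn).
have H := @filterI _ _ Fz _ _ Dn (@filterI _ _ Fz _ _
  (polydisc_max_usc Dz h1) (polydisc_max_lsc Dz h2)).
apply: (@filterS _ _ Fz _ _ _ H) => z' [Dz' [/(_ Dz') a1 /(_ Dz') a2]].
by rewrite ltr_norml; apply/andP; split; lra.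
Qed.

(** At [z] use the sub-mean value inequality of the single function [f (had v z)] for a
factor [v] that attains the maximum. *)
Lemma polydisc_max_psh : psh D (EFin \o polydisc_max f).
Proof.
split.
- by move=> z _; rewrite ltry.
- move=> z a Dz /=; rewrite lte_fin => /(polydisc_max_usc Dz).
  by apply: filterS => z' /= h Dz'; rewrite lte_fin h.
- move=> z w Dzw.
  have Dz : D z by have := Dzw 0; rewrite normr0 scale0r addr0; apply; exact: ler01.
  have [v pv [/= -> _]] := polydisc_maxP Dz.
  have hadD (l : R[i]) : had v z + l *: had v w = had v (z + l *: w).
    by apply/rowP => j; rewrite !mxE mulrDr mulrCA.
  case: pf => _ _ /(_ (had v z) (had v w)) h.
  apply: le_trans (h _) _.
    by move=> l l1; rewrite hadD; apply: complete_had => //; exact: Dzw.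
  rewrite lee_pmul2l // ?lte_fin ?invr_gt0 ?mulr_gt0 ?pi_gt0 //.
  apply: integral_mono => t _ /=; rewrite hadD lee_fin.
  have Dt : D (z + expi t *: w) by apply: Dzw; rewrite norm_expi.
  by have [u pu [_]] := polydisc_maxP Dt; exact.
Qed.

End Fixed.
End Hull.

(** * Gradients and normals *)

Section Gradient.
Local Open Scope complex_scope.
Context {R : realType} {n : nat}.
Local Notation C := (R[i])^o.
Local Notation Cn := 'rV[C]_n.
Implicit Types (D U : set Cn) (f rho : Cn -> R) (p q z w v g : Cn).

Lemma rdotC v w : rdot v w = rdot w v.
Proof. by apply: eq_bigr => j _; rewrite mulrC [_ * complex.Im _]mulrC. Qed.

Lemma rdotDl v w g : rdot (v + w) g = rdot v g + rdot w g.
Proof.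
rewrite -big_split; apply: eq_bigr => j _ /=; rewrite mxE.
by case: (v ord0 j) (w ord0 j) => [a b] [c d] /=; ring.
Qed.

Lemma rdotZl (t : R) v g : rdot (t%:C *: v) g = t * rdot v g.
Proof.
rewrite /rdot big_distrr; apply: eq_bigr => j _ /=; rewrite mxE.
by case: (v ord0 j) => [a b] /=; ring.
Qed.

Lemma rdotNl v g : rdot (- v) g = - rdot v g.
Proof.
rewrite /rdot -sumrN; apply: eq_bigr => j _ /=; rewrite mxE.
by case: (v ord0 j) => [a b] /=; ring.
Qed.

Lemma rdot_ge0 v : 0 <= rdot v v.
Proof. by apply: sumr_ge0 => j _; rewrite addr_ge0 // -expr2 sqr_ge0. Qed.

Lemma rdot_gt0 v : v != 0 -> 0 < rdot v v.
Proof.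
move=> v0; rewrite lt_neqAle rdot_ge0 andbT; apply: contraNneq v0 => /esym/eqP.
rewrite psumr_eq0; last by move=> j _; rewrite addr_ge0 // -expr2 sqr_ge0.
move=> /allP h; apply/eqP/rowP => j; rewrite mxE.
have /implyP/(_ isT) := h j (mem_index_enum j).
case: (v ord0 j) => [a b] /=; rewrite -!expr2 paddr_eq0 ?sqr_ge0 // !sqrf_eq0.
by move=> /andP[/eqP -> /eqP ->].
Qed.

Lemma rdot_delta (j : 'I_n) g : rdot (delta_mx ord0 j) g = complex.Re (g ord0 j).
Proof.
rewrite /rdot (bigD1 j) //= big1 => [|k kj].
  by rewrite mxE !eqxx /= mul1r mul0r !addr0.
by rewrite mxE eqxx (negbTE kj) /= !mul0r addr0.
Qed.

Lemma rdot_idelta (j : 'I_n) g :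
  rdot ((0 +i* 1 : R[i]) *: delta_mx ord0 j) g = complex.Im (g ord0 j).
Proof.
rewrite /rdot (bigD1 j) //= big1 => [|k kj].
  by rewrite 2![in LHS]mxE !eqxx mulr1 /= mul0r mul1r addr0 add0r.
by rewrite 2![in LHS]mxE eqxx (negbTE kj) mulr0 /= !mul0r addr0.
Qed.

Lemma rdot_suml (I : Type) (r : seq I) (x : I -> Cn) g :
  rdot (\sum_(i <- r) x i) g = \sum_(i <- r) rdot (x i) g.
Proof.
elim: r => [|i r IH]; last by rewrite !big_cons rdotDl IH.
by rewrite !big_nil -(scale0r (0 : Cn)) (rdotZl 0) mul0r.
Qed.

(** Continuous directional derivatives; that the derivative is linear in the direction
is a consequence, [rderiveD] and [rderiveZ]. *)
Definition C1_on U f := (forall v z, U z -> derivable (rline f z v) 0 1) /\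
  (forall v z, U z -> {for z, continuous (rderive v f)}).

Lemma smooth_C1 U f : smooth_on U f -> C1_on U f.
Proof.
move=> /(_ 1%N) [_ h]; split => v z Uz; have [h1 [h2 _]] := h v.
  exact: h1.
exact: h2.
Qed.

Section C1.
Variables (U : set Cn) (f : Cn -> R).
Hypotheses (oU : open U) (f1 : C1_on U f).

Lemma is_derive_rline z v (t : R) : U (z + t%:C *: v) ->
  is_derive t 1 (rline f z v) (rderive v f (z + t%:C *: v)).
Proof.
move=> Ut.
have /derivableP := f1.1 v _ Ut; rewrite -derive1E -/(rderive v f _) => dg.
have -> : rline f z v = (fun s => rline f (z + t%:C *: v) v (s + - t)).
  apply/funext => s; rewrite /rline; congr f.
  by rewrite -addrA -scalerDl -rmorphD /= [t + _]addrC subrK.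
have ds := der_add (der_id t) (der_const (- t) t).
have dg' : is_derive (t + - t) 1 (rline f (z + t%:C *: v) v) (rderive v f (z + t%:C *: v)).
  by rewrite subrr.
by have := der_comp ds dg'; rewrite addr0 mul1r.
Qed.

Lemma rline_mvt z v (t : R) : 0 <= t -> (forall s, 0 <= s <= t -> U (z + s%:C *: v)) ->
  exists2 s, 0 <= s <= t & f (z + t%:C *: v) - f z = t * rderive v f (z + s%:C *: v).
Proof.
move=> t0 Us.
have [||s] := @MVT_segment R (rline f z v) (fun s => rderive v f (z + s%:C *: v)) 0 t t0.
- move=> s; rewrite in_itv /= => /andP[s0 st]; apply: is_derive_rline.
  by apply: Us; rewrite !ltW.
- apply: continuous_in_subspaceT => s; rewrite inE /= in_itv /= => /Us /is_derive_rline ds.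
  by apply: differentiable_continuous; apply/derivable1_diffP; exact: ex_derive.
rewrite in_itv /= => st; rewrite /rline scale0r addr0 subr0 mulrC => e.
by exists s.
Qed.

Lemma near_rline z v (P : set Cn) : nbhs z P ->
  \forall d \near 0^'+, forall s : R, 0 <= s <= d -> P (z + s%:C *: v).
Proof.
move=> zP.
have c0 : (z + (s%:C : C) *: v : Cn) @[s --> (0 : R)] --> z.
  have := @cvg_affine R n R (nbhs (0 : R)) _ (fun s => s%:C : C) (0%:C : C) z v.
  rewrite scale0r addr0; apply.
  by apply: cvg_complex; [exact: cvg_id|exact: cvg_cst].
have /nbhs_ballP [e /= e0 he] := c0 _ zP.
near=> d => s /andP[s0 sd]; apply: he.
rewrite /ball /= sub0r normrN ger0_norm //; apply: le_lt_trans sd _.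
by near: d; exact: nbhs_right_lt.
Unshelve. all: by end_near. Qed.

Lemma near_rline2 z v w (P : set Cn) : nbhs z P ->
  \forall d \near 0^'+, forall s t : R, 0 <= s <= d -> 0 <= t <= d ->
    P (z + s%:C *: v + t%:C *: w).
Proof.
move=> zP.
have c0 (o : R * R) : (z + (st.1%:C : C) *: v + (st.2%:C : C) *: w : Cn) @[st --> o] -->
    (z + (o.1%:C : C) *: v + (o.2%:C : C) *: w : Cn).
  apply: cvgD.
    apply: cvgD; first exact: cvg_cst.
    apply: cvgZ; last exact: cvg_cst.
    by apply: cvg_complex; [exact: cvg_fst|exact: cvg_cst].
  apply: cvgZ; last exact: cvg_cst.
  by apply: cvg_complex; [exact: cvg_snd|exact: cvg_cst].
have {}c0 := c0 (0, 0); rewrite /= !scale0r !addr0 in c0.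
have [[P1 P2] [/= /nbhs_ballP [e1 /= e10 he1] /nbhs_ballP [e2 /= e20 he2]] h] := c0 _ zP.
near=> d => s t /andP[s0 sd] /andP[t0 td]; apply: (h (s, t)); split => /=.
  apply: he1; rewrite /ball /= sub0r normrN ger0_norm //; apply: le_lt_trans sd _.
  by near: d; exact: nbhs_right_lt.
apply: he2; rewrite /ball /= sub0r normrN ger0_norm //; apply: le_lt_trans td _.
by near: d; exact: nbhs_right_lt.
Unshelve. all: by end_near. Qed.

Lemma three_epsilons (a b c b' c' e : R) : `|c - c'| < e / 3 -> `|b - b'| < e / 3 ->
  `|a - (b' + c')| < e / 3 -> `|a - (b + c)| <= e.
Proof.
rewrite !ltr_norml ler_norml => /andP[x1 x2] /andP[y1 y2] /andP[z1 z2].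
by apply/andP; split; lra.
Qed.

(** The increment along [v + w] is the sum of the increments along [v] and then [w].
The mean value theorem turns each of them into [d] times a directional derivative
at a point close to [z]. *)
Lemma rderiveD z v w : U z -> rderive (v + w) f z = rderive v f z + rderive w f z.
Proof.
move=> Uz; apply/eqP; rewrite -subr_eq0 -normr_le0.
apply/ler_addgt0Pr => e e0; rewrite add0r.
have e3 : 0 < e / 3 by rewrite divr_gt0.
have Fz := nbhs_filter (z : Cn).
have Unbhs : nbhs z U by move: oU; rewrite openE; apply.
have close x : nbhs z (fun y => `|rderive x f z - rderive x f y| < e / 3).
  by have /cvgrPdist_lt/(_ _ e3) := f1.2 x z Uz.
have h1 := near_rline (v + w) (@filterI _ _ Fz _ _ Unbhs (close (v + w))).
have h2 := near_rline v (@filterI _ _ Fz _ _ Unbhs (close v)).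
have h3 := near_rline2 v w (@filterI _ _ Fz _ _ Unbhs (close w)).
have [d [d0 [{}h1 [{}h2 {}h3]]]] :=
  filter_ex (filterI (@nbhs_right_gt R 0) (filterI h1 (filterI h2 h3))).
have {}h1 : forall s, 0 <= s <= d -> U (z + s%:C *: (v + w)) /\
   `|rderive (v + w) f z - rderive (v + w) f (z + s%:C *: (v + w))| < e / 3 := h1.
have {}h2 : forall s, 0 <= s <= d -> U (z + s%:C *: v) /\
   `|rderive v f z - rderive v f (z + s%:C *: v)| < e / 3 := h2.
have {}h3 : forall s t, 0 <= s <= d -> 0 <= t <= d -> U (z + s%:C *: v + t%:C *: w) /\
   `|rderive w f z - rderive w f (z + s%:C *: v + t%:C *: w)| < e / 3 := h3.
have dd : 0 <= d <= d by rewrite ltW //= lexx.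
(* The path z, z + d v, z + d v + d w against the diagonal from z to its end. *)
have [s1 s1d e1] := rline_mvt (ltW d0) (fun s sd => (h1 s sd).1).
have [s2 s2d e2] := rline_mvt (ltW d0) (fun s sd => (h2 s sd).1).
have [s3 s3d e4] := rline_mvt (ltW d0) (fun s sd => (h3 d s dd sd).1).
have key : rderive (v + w) f (z + s1%:C *: (v + w)) =
  rderive v f (z + s2%:C *: v) + rderive w f (z + d%:C *: v + s3%:C *: w).
  apply: (mulfI (x := d)); first by rewrite gt_eqF.
  by rewrite mulrDr -e1 -e2 -e4 scalerDr addrA; ring.
have := (h1 _ s1d).2; have := (h2 _ s2d).2; have := (h3 _ _ dd s3d).2.
rewrite key.
move: (rderive (v + w) f z) (rderive v f z) (rderive w f z) => a b c.
move: (rderive v f _) (rderive w f _) => b' c'.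
exact: three_epsilons.
Qed.

Lemma rderiveZ z v (a : R) : U z -> rderive (a%:C *: v) f z = a * rderive v f z.
Proof.
move=> Uz.
have E : rline f z (a%:C *: v) = (fun t => rline f z v (a * t)).
  apply/funext => t; rewrite /rline scalerA -rmorphM /= mulrC //.
have d0 : is_derive (a * 0) 1 (rline f z v) (rderive v f z).
  rewrite mulr0; have := @is_derive_rline z v 0; rewrite scale0r addr0.
  by apply.
rewrite /rderive E derive1E.
have := der_comp (der_scale a (der_id 0)) d0.
by move=> h; rewrite derive_val mulr1.
Qed.

Lemma rderive0 z : U z -> rderive 0 f z = 0.
Proof. by move=> Uz; have := @rderiveZ z 0 0 Uz; rewrite scaler0 mul0r. Qed.

Lemma rderive_sum z (I : Type) (r : seq I) (v : I -> Cn) : U z ->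
  rderive (\sum_(i <- r) v i) f z = \sum_(i <- r) rderive (v i) f z.
Proof.
move=> Uz; elim: r => [|i r IH]; first by rewrite !big_nil rderive0.
by rewrite !big_cons rderiveD // IH.
Qed.

Lemma rderive_rdot z v : U z -> rderive v f z = rdot v (grad f z).
Proof.
move=> Uz.
have -> : v = \sum_j ((complex.Re (v ord0 j))%:C *: delta_mx ord0 j +
    (complex.Im (v ord0 j))%:C *: ((0 +i* 1 : R[i]) *: delta_mx ord0 j)) :> Cn.
  rewrite {1}[v]row_sum_delta; apply: eq_bigr => j _.
  rewrite scalerA -scalerDl; congr (_ *: _).
  case: (v ord0 j) => a b; apply/eqP; rewrite eq_complex /=.
  by apply/andP; split; apply/eqP; ring.
rewrite rderive_sum // rdot_suml; apply: eq_bigr => j _.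
rewrite rderiveD // !rderiveZ // rdotDl !rdotZl rdot_delta rdot_idelta.
by congr (_ * _ + _ * _); rewrite mxE.
Qed.

End C1.
End Gradient.

Section Normal.
Local Open Scope complex_scope.
Context {R : realType} {n : nat}.
Local Notation C := (R[i])^o.
Local Notation Cn := 'rV[C]_n.
Implicit Types (D U : set Cn) (f rho : Cn -> R) (p q z w v g xi : Cn).

Lemma defining_bd0 D U rho xi : open D -> bd D xi -> local_defining D xi U rho -> rho xi = 0.
Proof.
move=> oD [clxi nintxi] [oU Uxi smU DU _].
have crho : {for xi, continuous rho} by have [h _] := smU 0%N; exact: h.
apply/eqP; rewrite eq_le; apply/andP; split; rewrite leNgt; apply/negP => r0.
  have nU : nbhs xi U by move: oU; rewrite openE; apply.
  have nr : nbhs xi [set z | 0 < rho z].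
    have /cvgrPdist_lt/(_ _ r0) := crho.
    apply: (@filterS _ _ (nbhs_filter (xi : Cn))) => z.
    by rewrite ltr_norml => /andP[_]; rewrite ltrBlDr ltrDl.
  have [z [Dz [Uz rz]]] := clxi _ (@filterI _ _ (nbhs_filter (xi : Cn)) _ _ nU nr).
  have : (D `&` U) z by [].
  by rewrite DU => -[/= /lt_trans/(_ rz)]; rewrite ltxx.
apply: nintxi.
have : (D `&` U) xi by rewrite DU.
by move=> [Dxi _]; move: oD; rewrite openE; apply.
Qed.

Lemma defining_descent D U rho xi v : open D -> bd D xi -> local_defining D xi U rho ->
  rdot v (grad rho xi) < 0 -> \forall t \near 0^'+, D (xi + t%:C *: v).
Proof.
move=> oD bxi ld; have rho0 := defining_bd0 oD bxi ld.
case: ld => [oU Uxi /smooth_C1 C1U DU _].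
rewrite -(rderive_rdot oU C1U _ Uxi) => dneg.
have nU : nbhs xi U by move: oU; rewrite openE; apply.
have nd : nbhs xi (fun z => rderive v rho z < 0).
  have dneg' : 0 < - rderive v rho xi by rewrite oppr_gt0.
  have /cvgrPdist_lt/(_ _ dneg') := C1U.2 v _ Uxi.
  apply: (@filterS _ _ (nbhs_filter (xi : Cn))) => z.
  by rewrite ltr_norml opprK => /andP[+ _]; rewrite ltrBrDr gtrDl.
have h1 := near_rline v (@filterI _ _ (nbhs_filter (xi : Cn)) _ _ nU nd).
apply: filterS2 h1 (@nbhs_right_gt R 0) => t h1 t0.
have {}h1 : forall s, 0 <= s <= t ->
  U (xi + s%:C *: v) /\ rderive v rho (xi + s%:C *: v) < 0 := h1.
have tt : 0 <= t <= t by rewrite ltW //= lexx.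
suff : (D `&` U) (xi + t%:C *: v) by case.
rewrite DU; split; last exact: (h1 _ tt).1.
have [s st] := rline_mvt C1U (ltW t0) (fun s sd => (h1 s sd).1).
by rewrite /= rho0 subr0 => ->; rewrite pmulr_rlt0 //; exact: (h1 _ st).2.
Qed.

Lemma defining_ascent D U rho xi v : open D -> bd D xi -> local_defining D xi U rho ->
  0 < rdot v (grad rho xi) -> \forall t \near 0^'+, ~ D (xi + t%:C *: v).
Proof.
move=> oD bxi ld; have rho0 := defining_bd0 oD bxi ld.
case: ld => [oU Uxi /smooth_C1 C1U DU _].
rewrite -(rderive_rdot oU C1U _ Uxi) => dpos.
have nU : nbhs xi U by move: oU; rewrite openE; apply.
have nd : nbhs xi (fun z => 0 < rderive v rho z).
  have /cvgrPdist_lt/(_ _ dpos) := C1U.2 v _ Uxi.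
  apply: (@filterS _ _ (nbhs_filter (xi : Cn))) => z.
  by rewrite ltr_norml => /andP[_]; rewrite ltrBlDr ltrDl.
have h1 := near_rline v (@filterI _ _ (nbhs_filter (xi : Cn)) _ _ nU nd).
apply: filterS2 h1 (@nbhs_right_gt R 0) => t h1 t0 Dt.
have {}h1 : forall s, 0 <= s <= t ->
  U (xi + s%:C *: v) /\ 0 < rderive v rho (xi + s%:C *: v) := h1.
have tt : 0 <= t <= t by rewrite ltW //= lexx.
have : (D `&` U) (xi + t%:C *: v) by split => //; exact: (h1 _ tt).1.
rewrite DU => -[/= rneg _].
have [s st] := rline_mvt C1U (ltW t0) (fun s sd => (h1 s sd).1).
rewrite /= rho0 subr0 => e; move: rneg; rewrite e pmulr_rlt0 // ltNge.
by rewrite ltW //; exact: (h1 _ st).2.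
Qed.

(** If [v] points strictly inside for one defining function, it cannot point strictly
outside for the other.  So the open half-space of one gradient lies in the closed
half-space of the other; letting the strict inequality degenerate gives the same
for the boundary hyperplane, and [w] and [- w] are treated alike. *)
Lemma tangent_indep D U1 U2 rho1 rho2 xi w : open D -> bd D xi ->
  local_defining D xi U1 rho1 -> local_defining D xi U2 rho2 ->
  rdot w (grad rho1 xi) = 0 -> rdot w (grad rho2 xi) = 0.
Proof.
move=> oD bxi ld1 ld2.
have half v : rdot v (grad rho1 xi) < 0 -> rdot v (grad rho2 xi) <= 0.
  move=> v1; rewrite leNgt; apply/negP => v2.
  have [t [h1]] := filter_ex (filterI (defining_descent oD bxi ld1 v1)
    (defining_ascent oD bxi ld2 v2)).
  by apply.
have g10 : 0 < rdot (grad rho1 xi) (grad rho1 xi) by apply: rdot_gt0; case: ld1.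
have le0 v : rdot v (grad rho1 xi) = 0 -> rdot v (grad rho2 xi) <= 0.
  move=> v0; apply/ler_addgt0Pr => e e0; rewrite add0r.
  set g1 := grad rho1 xi in g10 v0 half *; set g2 := grad rho2 xi in half *.
  (* A push of size k along - g1 makes v strictly inward and costs at most e. *)
  pose k := e / (1 + `|rdot g1 g2|).
  have d0 : 0 < 1 + `|rdot g1 g2| by rewrite ltr_pwDl.
  have k0 : 0 < k by rewrite divr_gt0.
  have := half (v - k%:C *: g1).
  rewrite !rdotDl !rdotNl !rdotZl v0 sub0r oppr_lt0 mulr_gt0 // => /(_ isT).
  rewrite subr_le0 => /le_trans; apply.
  apply: (@le_trans _ _ (k * `|rdot g1 g2|)); first by rewrite ler_pM2l // ler_norm.
  by rewrite /k mulrAC ler_pdivrMr // ler_pM2l // lerDr.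
move=> w0; apply/eqP; rewrite eq_le le0 //=.
by rewrite -oppr_le0 -rdotNl le0 // rdotNl w0 oppr0.
Qed.

Lemma rdotBB v w : rdot (v - w) (v - w) = rdot v v + rdot w w - 2 * rdot w v.
Proof.
rewrite rdotDl rdotNl (rdotC v (v - w)) (rdotC w (v - w)) !rdotDl !rdotNl (rdotC v w).
by ring.
Qed.

(** The hyperplane is orthogonal to the normal, so by Pythagoras the distance from a
point of the normal to it is the distance to [xi]. *)
Lemma inward_normal_approach D xi z (alpha : R) : open D -> bd D xi -> 1 < alpha ->
  D z -> inward_normal D xi z -> approach_region D alpha xi z.
Proof.
move=> oD bxi a1 Dz [U [rho [ld [t t0 ez]]]]; split => //.
set g := grad rho xi in ez.
have g0 : 0 < rdot g g by apply: rdot_gt0; case: ld.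
have zxi : z - xi = - (t%:C *: g) by rewrite ez addrAC subrr sub0r.
have en : enorm (z - xi) = t * enorm g.
  rewrite /enorm zxi rdotNl rdotC rdotNl rdotZl rdotC rdotZl opprK mulrA.
  by rewrite sqrtrM -?expr2 ?sqr_ge0 // sqrtr_sqr gtr0_norm.
have tg0 : 0 < t * enorm g by rewrite mulr_gt0 // sqrtr_gt0.
have le_dist : t * enorm g <= dist_to (real_tangent D xi) z.
  apply: lb_le_inf.
    exists (enorm (z - xi)); exists xi => //; exists U, rho; split => //.
    by rewrite subrr -(scale0r (0 : Cn)) (rdotZl 0) mul0r.
  move=> _ [w [U' [rho' [ld' w0]]] <-].
  have {}w0 := tangent_indep oD bxi ld' ld w0.
  rewrite -en /enorm ler_sqrt ?rdot_ge0 //.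
  have -> : z - w = (z - xi) - (w - xi) by rewrite opprB addrA subrK.
  have ort : rdot (w - xi) (z - xi) = 0.
    by rewrite rdotC zxi rdotNl rdotZl rdotC w0 mulr0 oppr0.
  by rewrite (rdotBB (z - xi)) ort mulr0 subr0 lerDl rdot_ge0.
rewrite en; apply: lt_le_trans (_ : alpha * (t * enorm g) <= _).
  by rewrite ltr_pMl.
by rewrite ler_pM2l // (lt_trans ltr01).
Qed.

Lemma expiN (t : R) : expi (- t) = (expi t)^* :> R[i].
Proof. by rewrite /expi cosN sinN. Qed.

Lemma expiNM (t : R) : expi (- t) * expi t = 1 :> R[i].
Proof.
rewrite /expi cosN sinN; apply/eqP; rewrite eq_complex /=; apply/andP; split; apply/eqP.
  by rewrite mulNr opprK -!expr2 cos2Dsin2.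
by ring.
Qed.

Lemma torusK th z : had (torus (fun j => - th j)) (had (torus th) z) = z.
Proof. by apply/rowP => j; rewrite !mxE mulrA expiNM mul1r. Qed.

Lemma torusNK th z : had (torus th) (had (torus (fun j => - th j)) z) = z.
Proof.
have := torusK (fun j => - th j) z; congr (had (torus _) _ = _).
by apply/funext => j; rewrite opprK.
Qed.

Lemma hadD w z v : had w (z + v) = had w z + had w v.
Proof. by apply/rowP => j; rewrite !mxE mulrDr. Qed.

Lemma hadN w z : had w (- z) = - had w z.
Proof. by apply/rowP => j; rewrite !mxE mulrN. Qed.

Lemma hadZ w (t : R[i]) z : had w (t *: z) = t *: had w z.
Proof. by apply/rowP => j; rewrite !mxE mulrCA. Qed.

Lemma cvg_hadl w z : had w z' @[z' --> z] --> had w z.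
Proof.
by apply: (@cvg_had R Cn (nbhs z) (nbhs_filter (z : Cn)) n (fun=> w) id);
  [exact: cvg_cst|exact: cvg_id].
Qed.

Lemma rderive_had w f v z : rderive v (f \o had w) z = rderive (had w v) f (had w z).
Proof.
rewrite /rderive /rline; congr (derive1 _ 0).
by apply/funext => t; rewrite /= hadD hadZ.
Qed.

(** A diagonal linear map carries lines to lines, so that each directional derivative of
the composite is a directional derivative of [f] composed with the map. *)
Lemma Ck_had k w U f : Ck k U f -> Ck k (had w @^-1` U) (f \o had w).
Proof.
have cont f' : (forall z, U z -> {for z, continuous f'}) ->
    forall z, (had w @^-1` U) z -> {for z, continuous (f' \o had w)}.
  move=> h z Uz; apply: continuous_comp; first exact: cvg_hadl.
  exact: h.
elim: k f => [|k IH] f /= [cf df]; split => //; do ?exact: cont.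
move=> v; have [d1 d2] := df (had w v); split.
  move=> z Uz; have := d1 _ Uz.
  suff -> : rline (f \o had w) z v = rline f (had w z) (had w v) by [].
  by apply/funext => t; rewrite /rline /= hadD hadZ.
have -> : rderive v (f \o had w) = rderive (had w v) f \o had w.
  by apply/funext => z; exact: rderive_had.
exact: IH.
Qed.

Lemma rdot_torus th v g : rdot (had (torus (fun j => - th j)) v) g = rdot v (had (torus th) g).
Proof.
apply: eq_bigr => j _; rewrite !mxE expiN /expi.
by case: (v ord0 j) (g ord0 j) => [a b] [c d] /=; ring.
Qed.

(** Rotations are isometries for [rdot], so they carry the gradient of the defining
function along: normals are mapped to normals. *)
Lemma local_defining_torus D xi U rho th : multicircular D ->
  local_defining D xi U rho ->
  let S := had (torus (fun j => - th j)) in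
  local_defining D (had (torus th) xi) (S @^-1` U) (rho \o S) /\
  grad (rho \o S) (had (torus th) xi) = had (torus th) (grad rho xi).
Proof.
move=> mD [oU Uxi smU DU g0] S.
have gE : grad (rho \o S) (had (torus th) xi) = had (torus th) (grad rho xi).
  apply/rowP => j; rewrite [LHS]mxE !rderive_had torusK.
  rewrite !(rderive_rdot oU (smooth_C1 smU) _ Uxi) !rdot_torus rdot_delta rdot_idelta.
  by case: (had _ _ _ _).
have SD z : D (S z) <-> D z.
  split => [/(mD th)|/(mD (fun j => - th j))]; congr D; last first.
    by apply/rowP => j; rewrite !mxE.
  by rewrite -[RHS](torusNK th); apply/rowP => j; rewrite !mxE.
split => //; split.
- apply: open_comp => // z _; exact: cvg_hadl.
- by rewrite /= /S torusK.
- by move=> k; exact: Ck_had.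
- apply/seteqP; split => z [/= h1 h2]; split => //=.
    have : (D `&` U) (S z) by split => //; exact/SD.
    by rewrite DU => -[].
  apply/SD; have : (D `&` U) (S z) by rewrite DU.
  by case.
- rewrite gE; apply: contra_neq g0 => h.
  by rewrite -[grad rho xi](torusK th) h; apply/rowP => j; rewrite !mxE mulr0.
Qed.

End Normal.

(** * Upper limits *)

Section Limsup.
Context {R : realType} {T : topologicalType}.
Implicit Types (u v : T -> \bar R) (F G : set_system T) (A B : set T).

Lemma limf_esup_le u F A (a : \bar R) : F A -> (forall x, A x -> (u x <= a)%E) ->
  (limf_esup u F <= a)%E.
Proof.
move=> FA ua; apply: le_trans (ereal_inf_lbound _) _; first by exists A.
by apply: ge_ereal_sup => _ [x Ax <-]; exact: ua.
Qed.

Lemma limf_esup_lt u F (a : \bar R) : (limf_esup u F < a)%E ->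
  exists2 A, F A & forall x, A x -> (u x < a)%E.
Proof.
move=> /ereal_inf_lt [_ [A FA <-] ua]; exists A => // x Ax.
by apply: le_lt_trans ua; apply: ereal_sup_ubound; exists x.
Qed.

Lemma limf_esup_subfilter u F G : G `<=` F -> (limf_esup u F <= limf_esup u G)%E.
Proof.
move=> GF; apply: le_ereal_inf_tmp => _ [A GA <-].
by apply: ereal_inf_lbound; exists A => //; exact: GF.
Qed.

Lemma limf_esup_withinS u A B (x : T) : A `<=` B ->
  (limf_esup u (within A (nbhs x)) <= limf_esup u (within B (nbhs x)))%E.
Proof.
move=> AB; apply: limf_esup_subfilter => V.
by apply: (@filterS _ _ (nbhs_filter x)) => y h /AB; exact: h.
Qed.

Lemma eq_limf_esup u v A (x : T) : (forall y, A y -> u y = v y) ->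
  limf_esup u (within A (nbhs x)) = limf_esup v (within A (nbhs x)).
Proof.
suff le u' v' : (forall y, A y -> u' y = v' y) ->
    (limf_esup u' (within A (nbhs x)) <= limf_esup v' (within A (nbhs x)))%E.
  by move=> uv; apply/eqP; rewrite eq_le !le // => y Ay; rewrite uv.
move=> uv; apply: le_ereal_inf_tmp => _ [V nV <-].
apply: (@limf_esup_le _ _ (V `&` A)).
  by apply: (@filterS _ _ (nbhs_filter x) _ _ _ nV) => y h Ay; split => //; exact: h.
by move=> y [Vy Ay]; rewrite uv //; apply: ereal_sup_ubound; exists y.
Qed.

End Limsup.

(** * Comparison of the extremal functions *)

Section Main.
Local Open Scope complex_scope.
Context {R : realType} {n : nat}.
Local Notation C := (R[i])^o.
Local Notation Cn := 'rV[C]_n.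
Implicit Types (D K U : set Cn) (f rho : Cn -> R) (u : Cn -> \bar R) (p q z w v g xi : Cn).

(** On a set where [u <= 0] this is [max (u, -1)]; clipping from above as well makes it
real-valued everywhere. *)
Definition clip u z : R := fine (maxe (mine (u z) 0%E) (-1)%:E).

Lemma clipE u z : (clip u z)%:E = maxe (mine (u z) 0%E) (-1)%:E.
Proof.
rewrite /clip fineK //.
have h1 : ((-1)%:E <= maxe (mine (u z) 0%E) (-1)%:E)%E by rewrite le_max lexx orbT.
have h2 : (maxe (mine (u z) 0%E) (-1)%:E <= 0)%E.
  by rewrite ge_max ge_min lexx orbT /= lee_fin lerN10.
by rewrite fin_numE; apply/andP; split; apply/eqP => e; move: h1 h2; rewrite e.
Qed.

Lemma clipE_le0 u z : (u z <= 0)%E -> (clip u z)%:E = maxe (u z) (-1)%:E.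
Proof. by move=> u0; rewrite clipE; congr maxe; apply/min_idPl. Qed.

Lemma clip_le0 u z : clip u z <= 0.
Proof. by rewrite -lee_fin clipE ge_max ge_min lexx orbT /= lee_fin lerN10. Qed.

Lemma clip_geN1 u z : -1 <= clip u z.
Proof. by rewrite -lee_fin clipE le_max lexx orbT. Qed.

Lemma le_clip u z : (u z <= 0)%E -> (u z <= (clip u z)%:E)%E.
Proof. by move=> u0; rewrite clipE_le0 // le_max lexx. Qed.

Lemma clip_lt u z (a : R) : (u z <= 0)%E -> -1 < a -> (u z < a%:E)%E -> clip u z < a.
Proof. by move=> u0 a1 ua; rewrite -lte_fin clipE_le0 // gt_max ua lte_fin a1. Qed.

Lemma psh_clip D u : psh_le0 D u -> psh D (EFin \o clip u).
Proof.
move=> [[_ uu su] u0]; split.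
- by move=> z _; rewrite ltry.
- move=> z a Dz /=; rewrite clipE_le0 ?u0 // gt_max lte_fin => /andP[ua a1].
  have := uu _ _ Dz ua; apply: (@filterS _ _ (nbhs_filter (z : Cn))) => w h Dw.
  by rewrite lte_fin; apply: clip_lt => //; [exact: u0|exact: h].
- move=> z w Dzw.
  have Dt (t : R) : D (z + expi t *: w) by apply: Dzw; rewrite norm_expi.
  have Dz : D z by have := Dzw 0; rewrite normr0 scale0r addr0; apply; exact: ler01.
  have p20 : 0 < 2 * pi :> R by rewrite mulr_gt0 // pi_gt0.
  have p20' : (0 < ((2 * pi)^-1)%:E :> \bar R)%E by rewrite lte_fin invr_gt0.
  rewrite /= {1}clipE_le0 ?u0 // ge_max; apply/andP; split.
    apply: le_trans (su _ _ Dzw) _; rewrite lee_pmul2l //.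
    by apply: integral_mono => t _; apply: le_clip; exact: u0.
  have cN1 : continuous (fun _ : R => -1 : R) by move=> x; exact: cvg_cst.
  apply: (@le_trans _ _ (((2 * pi)^-1)%:E *
      \int[lebesgue_measure]_(t in `[0%R, (2 * pi)%R]) (-1 : R)%:E)%E).
    by rewrite (integral_has_mean cN1 (has_mean_cst _)) -EFinM lee_fin mulrA mulVf
      ?gt_eqF // mul1r.
  rewrite lee_pmul2l //.
  by apply: integral_mono => t _; rewrite lee_fin clip_geN1.
Qed.

Lemma psh_dilate D f (r : R) : balanced D -> 0 <= r <= 1 -> psh D (EFin \o f) ->
  psh D (fun z => (f (r%:C *: z))%:E).
Proof.
move=> bD /andP[r0 r1] [_ uf sf].
have rn : `|r%:C : R[i]| <= 1 by rewrite ger0_norm ?(lecR 0 r) // (lecR r 1).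
split.
- by move=> z _; rewrite ltry.
- move=> z a Dz fa.
  have cr : (r%:C *: z' : Cn) @[z' --> z] --> (r%:C *: z : Cn).
    by apply: (@cvgZ _ _ _ (nbhs (z : Cn)) (nbhs_filter (z : Cn)) (fun=> r%:C : C) id);
      [exact: cvg_cst|exact: cvg_id].
  have h : nbhs z (fun z' => D (r%:C *: z') -> ((EFin \o f) (r%:C *: z') < a%:E)%E) :=
    cr _ (uf _ _ (bD _ _ Dz rn) fa).
  apply: (@filterS _ _ (nbhs_filter (z : Cn)) _ _ _ h) => z' h' Dz'.
  exact: (h' (bD _ _ Dz' rn)).
- move=> z w Dzw.
  have E (l : R[i]) : r%:C *: (z + l *: w) = r%:C *: z + l *: (r%:C *: w).
    by rewrite scalerDr !scalerA [r%:C * l]mulrC.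
  have := sf (r%:C *: z) (r%:C *: w); under eq_integral do rewrite -E /=.
  apply => l l1; rewrite -E; apply: bD rn; exact: Dzw.
Qed.

(** The same parameters [t m] serve for all rotated points, which is what gives
convergence at every point of the torus for one sequence. *)
Lemma normal_sequence D xi : smoothly_bounded D -> open D -> multicircular D -> bd D xi ->
  exists zs : nat -> Cn, [/\ forall m, D (zs m), zs m @[m --> \oo] --> xi &
    forall th m, inward_normal D (had (torus th) xi) (had (torus th) (zs m))].
Proof.
move=> [_ sb] oD mD bxi; have [U [rho ld]] := sb _ bxi.
set g := grad rho xi.
have g0 : 0 < rdot g g by apply: rdot_gt0; case: ld.
have := @defining_descent R n D U rho xi (- g) oD bxi ld.
rewrite -/g rdotNl oppr_lt0 => /(_ g0) /nbhs_ballP [d /= d0 hd].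
pose t (m : nat) : R := (d / 2) * harmonic m.
have t0 m : 0 < t m by rewrite mulr_gt0 ?divr_gt0 // harmonic_gt0.
have td m : t m < d.
  apply: (@le_lt_trans _ _ (d / 2)); last by rewrite ltr_pdivrMr // ltr_pMr // ltr1n.
  by rewrite ler_piMr ?divr_ge0 ?(ltW d0) // /harmonic /= invf_le1 ?ltr0n // ler1n.
exists (fun m => xi - (t m)%:C *: g); split.
- move=> m; have := hd (t m); rewrite scalerN; apply; last exact: t0.
  by rewrite /ball /= sub0r normrN gtr0_norm.
- have ct : t m @[m --> \oo] --> 0.
    rewrite -(mulr0 (d / 2)); apply: cvgM; [exact: cvg_cst|exact: cvg_harmonic].
  have := @cvg_affine R n nat \oo _ (fun m => (t m)%:C : C) (0%:C : C) xi (- g).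
  rewrite scale0r addr0 => H.
  rewrite (_ : (fun m => xi - (t m)%:C *: g) = (fun m => xi + (t m)%:C *: - g)).
    by apply: H; apply: cvg_complex => //; exact: cvg_cst.
  by apply/funext => m; rewrite scalerN.
- move=> th m; have [ld' gE] := local_defining_torus th mD ld.
  exists (had (torus (fun j => - th j)) @^-1` U), (rho \o had (torus (fun j => - th j))).
  split => //; exists (t m); first exact: t0.
  by rewrite gE hadD hadN hadZ.
Qed.

Section Comparison.
Variables (D K : set Cn).
Hypotheses (D_smooth : smoothly_bounded D) (cD : complete_pseudoconvex_Reinhardt D).
Hypotheses (K_bd : K `<=` bd D) (K_circ : multicircular K).
Hypothesis K_hyp : forall z, K z -> forall j : 'I_n, z ord0 j <> 0.

Let oD : open D. Proof. by case: cD => [[]]. Qed.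
Let mD : multicircular D. Proof. by case: cD. Qed.
Let bD : balanced D. Proof. by case: cD. Qed.
Let K_cl x : K x -> closure D x. Proof. by move=> /K_bd []. Qed.

(** For a function continuous up to the boundary, [ustar] is bounded by the boundary
value. *)
Lemma omega1_le_omega z : (omega1 z K D <= omega z K D)%E.
Proof.
apply: ereal_sup_le => _ [u [psu finu cu uK] <-]; exists u => //; split => // x Kx.
have /subspace_continuousP/(_ _ (K_cl Kx)) cx := cu.
apply/lee_addgt0Pr => e e0.
have lt1 : (u x < -1%:E + e%:E)%E.
  by apply: le_lt_trans (uK _ Kx) _; rewrite -EFinN -EFinD lte_fin ltrDl.
have /cx h : nbhs (u x) [set y | (y < -1%:E + e%:E)%E].
  by apply: open_nbhs_nbhs; split => //; exact: open_ereal_lt_ereal.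
apply: (@limf_esup_le _ _ _ _ [set y | (u y < -1%:E + e%:E)%E]); last by move=> y /ltW.
apply: (@filterS _ _ (nbhs_filter (x : Cn)) _ _ _ h) => y /= hy Dy; apply: hy.
exact: subset_closure.
Qed.

Lemma omega_le_omega_tilde z : (omega z K D <= omega_tilde z K D)%E.
Proof.
apply: ereal_sup_le => _ [u [psu uK] <-]; exists u => //; split => // x Kx.
apply: ge_ereal_sup => _ [alpha _ <-]; apply: le_trans (uK _ Kx).
by apply: limf_esup_withinS => y [].
Qed.

Lemma omega_tilde_le_omega3 z : (omega_tilde z K D <= omega3 z K D)%E.
Proof.
apply: ereal_sup_le => _ [u [psu uK] <-]; exists u => //; split => // x Kx.
apply: le_trans (uK _ Kx).
have two1 : 1 < 2 :> R by rewrite ltr1n.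
apply: (@le_trans _ _ (limf_esup u (within (approach_region D 2 x) (nbhs x)))).
  apply: limf_esup_withinS => y [Dy Ny].
  by apply: inward_normal_approach => //; exact: K_bd.
by apply: ereal_sup_ubound; exists 2.
Qed.

Lemma clip_le_on_polydisc u w xi (r : R) : psh_le0 D u ->
  (forall x, K x -> (limf_esup u (within (D `&` inward_normal D x) (nbhs x)) <= - 1%:E)%E) ->
  K xi -> 0 <= r < 1 -> (forall j, `|w ord0 j : R[i]| <= r%:C) ->
  clip u (had w xi) <= -1.
Proof.
move=> psu uK Kxi r01 wr.
have [zs [Dzs zsxi nzs]] := normal_sequence D_smooth oD mD (K_bd Kxi).
apply: (boundary_to_polydisc cD (psh_clip psu) _ Dzs zsxi (K_hyp Kxi) _ r01 wr).
  by move=> z _; exact: clip_le0.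
move=> th e e0.
have Kx : K (had (torus th) xi).
  by have := K_circ th Kxi; congr K; apply/rowP => j; rewrite !mxE.
have lt1 : (limf_esup u (within (D `&` inward_normal D (had (torus th) xi))
    (nbhs (had (torus th) xi))) < (-1 + e)%:E)%E.
  by apply: le_lt_trans (uK _ Kx) _; rewrite -EFinN lte_fin ltrDl.
have [A nA uA] := limf_esup_lt lt1.
have cz : had (torus th) (zs m) @[m --> \oo] --> had (torus th) xi.
  exact: (@cvg_had R nat \oo _ n (fun=> torus th) zs (torus th) xi (cvg_cst _) zsxi).
have h : \forall m \near \oo, (D `&` inward_normal D (had (torus th) xi))
    (had (torus th) (zs m)) -> A (had (torus th) (zs m)) := cz _ nA.
apply: filterS h => m hm.
have Dm : D (had (torus th) (zs m)).
  by have := mD th (Dzs m); congr D; apply/rowP => j; rewrite !mxE.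
apply: clip_lt; first by case: psu => _; apply.
  by rewrite ltrDl.
by apply: uA; apply: hm; split.
Qed.

(** Dilation by [r < 1] moves the closure of [D] into [D], where the maximal function is
continuous, and moves [K] into the polydiscs where it equals [-1]. *)
Lemma dilate_le_omega1 u z (r : R) : psh_le0 D u ->
  (forall x, K x -> (limf_esup u (within (D `&` inward_normal D x) (nbhs x)) <= - 1%:E)%E) ->
  0 <= r < 1 -> ((polydisc_max (clip u) (r%:C *: z))%:E <= omega1 z K D)%E.
Proof.
move=> psu uK r01; have pf := psh_clip psu.
have r01' : 0 <= r <= 1 by case/andP: r01 => -> /ltW ->.
have rn : `|r%:C : R[i]| <= 1.
  by case/andP: r01' => r0 r1; rewrite ger0_norm ?(lecR 0 r) // (lecR r 1).
apply: ereal_sup_ubound; exists (fun y => (polydisc_max (clip u) (r%:C *: y))%:E) => //; split.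
- split; first by apply: psh_dilate => //; exact: polydisc_max_psh.
  move=> y Dy; rewrite lee_fin.
  have [w _ [-> _]] := polydisc_maxP cD pf (bD Dy rn); exact: clip_le0.
- by move=> x _.
- apply/subspace_continuousP => x clx.
  have cr : (r%:C *: x' : Cn) @[x' --> x] --> (r%:C *: x : Cn).
    by apply: (@cvgZ _ _ _ (nbhs (x : Cn)) (nbhs_filter (x : Cn)) (fun=> r%:C : C) id);
      [exact: cvg_cst|exact: cvg_id].
  apply: cvg_within_filter; apply: (cvg_EFin _ _).
    by near=> y.
  exact: (cvg_comp _ _ cr (polydisc_max_continuous cD pf (closure_dilate cD r01 clx))).
- move=> x Kx; rewrite -EFinN lee_fin.
  have [w pw [-> _]] := polydisc_maxP cD pf (closure_dilate cD r01 (K_cl Kx)).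
  have -> : had w (r%:C *: x) = had (r%:C *: w) x.
    by apply/rowP => j; rewrite !mxE mulrCA mulrA.
  apply: (clip_le_on_polydisc psu uK Kx r01) => j.
  rewrite mxE normrM ger0_norm ?(lecR 0 r) ?(andP r01).1 //.
  by apply: ler_piMr; [rewrite (lecR 0 r) (andP r01).1|exact: pw].
Unshelve. all: by end_near. Qed.

(** The dilates are competitors, and lower semicontinuity of the maximal function at [z]
suffices to let [r] tend to [1]. *)
Lemma omega3_le_omega1 z : D z -> (omega3 z K D <= omega1 z K D)%E.
Proof.
move=> Dz; apply: ge_ereal_sup => _ [u [psu uK] <-]; have pf := psh_clip psu.
apply: le_trans (le_clip (psu.2 _ Dz)) _.
apply: (@le_trans _ _ (polydisc_max (clip u) z)%:E).
  by rewrite lee_fin; exact: (le_polydisc_max cD pf).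
apply/lee_addgt0Pr => e e0.
have lte : polydisc_max (clip u) z - e < polydisc_max (clip u) z by rewrite ltrBlDr ltrDl.
have h := near_rline (- z) (polydisc_max_lsc cD pf Dz lte).
have [d [d0 [d1 hd]]] := filter_ex (filterI (@nbhs_right_gt R 0)
  (filterI (@nbhs_right_lt R 0 1 ltr01) h)).
have dd : 0 <= d <= d by rewrite ltW //= lexx.
have rE : z + d%:C *: - z = (1 - d)%:C *: z.
  by rewrite scalerN -{1}[z]scale1r -scalerBl rmorphB.
have r01 : 0 <= 1 - d < 1 by rewrite subr_ge0 (ltW d1) gtrBl.
have := hd d dd; rewrite rE.
have Dr : D ((1 - d)%:C *: z).
  by apply: closure_dilate => //; exact: subset_closure.
move=> /(_ Dr); rewrite ltrBlDr => /ltW.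
rewrite -lee_fin EFinD => /le_trans; apply.
by rewrite leeD2r //; exact: dilate_le_omega1.
Qed.

End Comparison.
End Main.

Theorem theorem2p11 (R : realType) (n : nat) (n_gt0 : (0 < n)%N)
  (D K : set 'Cn[R]_n)
  (D_smooth : smoothly_bounded D)
  (D_Reinhardt : complete_pseudoconvex_Reinhardt D)
  (K_bd : K `<=` bd D)
  (K_circ : multicircular K)
  (K_compact : compact K)
  (K_hyp : forall z, K z -> forall j : 'I_n, z ord0 j <> 0) :
  (forall z, D z ->
     [/\ omega1 z K D = omega z K D,
         omega z K D = omega_tilde z K D &
         omega_tilde z K D = omega3 z K D]) /\
  (forall x, closure D x ->
     [/\ ustar D (fun z => omega1 z K D) x = ustar D (fun z => omega z K D) x,
         ustar D (fun z => omega z K D) x =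
           ustar D (fun z => omega_tilde z K D) x &
         ustar D (fun z => omega_tilde z K D) x =
           ustar D (fun z => omega3 z K D) x]).
Proof.
have eqs z : D z -> [/\ omega1 z K D = omega z K D,
    omega z K D = omega_tilde z K D & omega_tilde z K D = omega3 z K D].
  move=> Dz.
  have h1 := omega1_le_omega K_bd z.
  have h2 := omega_le_omega_tilde D K z.
  have h3 := omega_tilde_le_omega3 D_Reinhardt K_bd z.
  have h4 := omega3_le_omega1 D_smooth D_Reinhardt K_bd K_circ K_hyp Dz.
  have h12 := le_trans h1 h2; have h23 := le_trans h2 h3.
  have h34 := le_trans h3 h4; have h41 := le_trans h4 h1.
  split; apply/eqP; rewrite eq_le.
  - by rewrite h1 (le_trans h23 h4).
  - by rewrite h2 (le_trans h3 h41).
  - by rewrite h3 (le_trans h4 h12).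
split=> // x _; split; apply: eq_limf_esup => z /eqs[] //.
Qed.
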